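(* Let $g\ge 0$, $k\ge 1$, $n\ge 1$ be integers with $2g-2+k>0$, and let $\Sigma$ be an oriented surface of genus $g$ with $k$ punctures $p_1,\dots,p_k$. Then $\Sigma$ has a triangulation with vertices exactly at the punctures whose dual graph is bipartite. Fix any such triangulation, and let $\mathcal G_n$ be the associated bipartite graph defined in the context, with its bands of zig-zag paths $\zeta_{i,1},\dots,\zeta_{i,n}$ attached to the punctures $p_i$, $i=1,\dots,k$. Let $\lambda_{i,j}\in\mathbb C^*$ ($1\le i\le k$, $1\le j\le n$) satisfy $\prod_{i,j}\lambda_{i,j}=1$. Then the $kn$ monomial equations $$(\text{monodromy along }\zeta_{i,j})=\lambda_{i,j}\qquad(1\le i\le k,\ 1\le j\le n)$$ on the space of $\mathbb C^*$-connections on $\mathcal G_n$ modulo gauge are independent apart from the single relation that the product of all the monodromies is $1$ (so they amount to $kn-1$ independent monomial equations), and the space of $\mathbb C^*$-connections on $\mathcal G_n$ modulo gauge satisfying them is isomorphic to $$(\mathbb C^* )^N,\qquad N=n^2(2g-2+k)-kn+2=2(g-1)n^2+(n^2-n)k+2 .$$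
   Context: Triangulations are allowed to have several edges with the same endpoints and loops (as is needed when $k$ is small); the number of triangles is $T=2(2g-2+k)$. The graphs $\mathcal G_\Sigma$ and $\mathcal G$. $\mathcal G_\Sigma$ is the (trivalent, bipartite) dual graph of the triangulation of $\Sigma$, with its ribbon structure (cyclic order of edges at each vertex) induced by the embedding in $\Sigma$. $\mathcal G$ is the same abstract graph with the cyclic order reversed at all black vertices. This ribbon structure embeds $\mathcal G$ in another punctured oriented surface $S$ (the conjugate surface), which is triangulated by $T$ triangles dual to the vertices of $\mathcal G$. The graph $\mathcal G_n$. Subdivide each triangle $t$ of the triangulation of $S$ into $n^2$ small triangles in the standard way: $n(n+1)/2$ ''upright'' ones (same orientation as $t$) and $n(n-1)/2$ ''inverted'' ones. $\mathcal G_n$ is the trivalent graph on $S$ dual to this subdivided triangulation (subdivisions of neighbouring triangles match along the common side). Colour its vertices as follows: if $t$ corresponds to a white (resp. black) vertex of $\mathcal G$, the upright small triangles of $t$ give white (resp. black) vertices and the inverted ones give black (resp. white) vertices. Then $\mathcal G_n$ is bipartite, and $\mathcal G_1=\mathcal G$. A zig-zag path on a bipartite graph embedded in an oriented surface is a closed path which turns maximally left at each black vertex and maximally right at each white vertex; with this convention each edge is traversed by zig-zag paths exactly twice, once in each direction. The zig-zag paths of $\mathcal G$ correspond to the peripheral curves around the punctures of $\Sigma$; the zig-zag paths of $\mathcal G_n$ come in $k$ bands of $n$ parallel ones, one band for each zig-zag path of $\mathcal G$, i.e. for each puncture $p_i$ of $\Sigma$. For each $i$ the $n$ zig-zag paths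 in the band of $p_i$ are labelled $\zeta_{i,1},\dots,\zeta_{i,n}$ in an arbitrary way. A $\mathbb C^*$-connection on a graph is an assignment of a one-dimensional vector space $\mathbb C_v\cong\mathbb C$ to each vertex and of an isomorphism (multiplication by a nonzero scalar) to each oriented edge, with inverse scalars for the reversed edge. The monodromy along a closed path is the product of the scalars along it. Connections are taken modulo gauge transformations (changes of basis in the spaces $\mathbb C_v$). *)

(* Defs.v *)
From HB Require Import structures.
From mathcomp Require Import all_boot all_order all_algebra all_fingroup.
From mathcomp Require Import reals complex.

Set Implicit Arguments.
Unset Strict Implicit.
Unset Printing Implicit Defensive.

Import GRing.Theory.

(* A closed connected oriented surface glued from finitely many triangles.
   [side] is the set of pairs (triangle, side of it); each side is oriented as
   part of the boundary of its triangle, and [next] is the following side,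
   counterclockwise, of the same triangle.  [glue] maps a side to the side of
   the neighbouring triangle it is identified with (reversing orientations).
   Loops and multiple edges are allowed. *)
Record triangulation := Triangulation {
  side : finType;
  next : {perm side};
  glue : {perm side};
  next3 : forall s, next (next (next s)) = s;
  next_neq : forall s, next s != s;
  glueK : forall s, glue (glue s) = s;
  glue_neq : forall s, glue s != s;
  side_connected : forall s t,
    connect [rel x y | (y == next x) || (y == glue x)] s t }.

Definition triangles (T : triangulation) := porbits (next T).
Definition edges (T : triangulation) := porbits (glue T).

(* If [s] starts at the vertex [v], so does [next (glue s)]: a vertex is
   encoded by the set of all sides that start at it. *)
Definition vertices (T : triangulation) := porbits (glue T * next T).

(* [T] triangulates the oriented surface of genus [g] with punctures
   [p 0, .., p (k - 1)], the vertices being exactly the punctures. *)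
Definition triangulates (g k : nat) (T : triangulation)
    (p : 'I_k -> {set side T}) : Prop :=
  [/\ injective p,
      [set p i | i : 'I_k] = vertices T
    & (#|vertices T|%:Z - #|edges T|%:Z + #|triangles T|%:Z = 2 - 2 * g%:Z)%R].

(* A dart is an edge oriented away from one of its endpoints; [rot] is the
   next dart, counterclockwise, at the same vertex, [opp] the same edge with
   the other orientation, and [white] the colour of the initial vertex. *)
Record ribbon := Ribbon {
  dart : finType;
  rot : {perm dart};
  opp : {perm dart};
  white : dart -> bool;
  rot3 : forall d, rot (rot (rot d)) = d;
  rot_neq : forall d, rot d != d;
  oppK : forall d, opp (opp d) = d;
  white_rot : forall d, white (rot d) = white d;
  white_opp : forall d, white (opp d) = ~~ white d }.

Definition vertex (G : ribbon) (d : dart G) : {set dart G} := porbit (rot G) d.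

(* A proper colouring of the vertices of the dual graph, i.e. the triangles. *)
Definition bicolouring (T : triangulation) (w : side T -> bool) : Prop :=
  (forall s, w (next T s) = w s) /\ (forall s, w (glue T s) = ~~ w s).

(* The dart attached to a side of [t] goes from [t] across that side. *)
Definition dual_graph (T : triangulation) (w : side T -> bool)
    (Hw : bicolouring w) : ribbon :=
  @Ribbon (side T) (next T) (glue T) w (@next3 T) (@next_neq T) (@glueK T)
    (proj1 Hw) (proj2 Hw).

Section Twist.
Variable G : ribbon.

Definition twist_fun (d : dart G) : dart G :=
  if white d then rot G d else ((rot G)^-1)%g d.

Lemma white_rotV (d : dart G) : white (((rot G)^-1)%g d) = white d.
Proof. by rewrite -[in RHS](permKV (rot G) d) white_rot. Qed.

Lemma white_twist_fun d : white (twist_fun d) = white d.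
Proof. by rewrite /twist_fun; case: ifP; rewrite ?white_rot ?white_rotV. Qed.

Lemma twist_inj : injective twist_fun.
Proof.
move=> x y exy; have wxy : white x = white y.
  by rewrite -(white_twist_fun x) exy white_twist_fun.
by move: exy; rewrite /twist_fun wxy; case: ifP => _ /perm_inj.
Qed.

(* Counterclockwise at white vertices, clockwise at black ones. *)
Definition twist : {perm dart G} := perm twist_inj.

Lemma white_twist d : white (twist d) = white d.
Proof. by rewrite permE white_twist_fun. Qed.

Lemma twist3 d : twist (twist (twist d)) = d.
Proof.
rewrite !permE; case wd: (white d).
  have E e : white e -> twist_fun e = rot G e by rewrite /twist_fun => ->.
  by rewrite !E ?white_rot ?rot3.
have E e : ~~ white e -> twist_fun e = (rot G)^-1%g e.
  by rewrite /twist_fun => /negbTE ->.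
by rewrite !E ?white_rotV ?wd // -[in LHS](rot3 d) !permK.
Qed.

Lemma twist_neq d : twist d != d.
Proof.
rewrite permE /twist_fun; case: ifP => _; first exact: rot_neq.
by rewrite -(inj_eq (@perm_inj _ (rot G))) permKV eq_sym rot_neq.
Qed.

(* The same graph, with the cyclic order reversed at the black vertices. *)
Definition conjugate : ribbon :=
  @Ribbon (dart G) twist (opp G) (@white G) twist3 twist_neq (@oppK G)
    white_twist (@white_opp G).

(* One step of a zig-zag path.  A path following [d] reaches the end of [d]
   along [opp d]; there, the dart following [opp d] counterclockwise is the
   rightmost turn (taken at white vertices), and the dart preceding it is the
   leftmost turn (taken at black vertices). *)
Definition zz : {perm dart G} := (opp G * twist)%g.

(* A zig-zag path, encoded by the set of the darts it follows: each dart is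
   followed exactly once. *)
Definition zigzags : {set {set dart G}} := porbits zz.

End Twist.

(* The zig-zag paths of the conjugate graph are the boundaries of the faces of
   the original one. *)
Lemma zz_conjugate (G : ribbon) : zz (conjugate G) = (opp G * rot G)%g.
Proof.
apply/permP => d; rewrite !permM !permE /twist_fun /=.
set e := opp G d; case we: (white e); first by rewrite !permE /twist_fun we.
apply: (perm_inj (s := twist G)); rewrite permKV permE /twist_fun.
by rewrite white_rot we permK.
Qed.

Section SmallTriangles.
Variable n : nat.

(* Let [s] be a side of a triangle, whose points have barycentric coordinates
   x, y, z >= 0 with x + y + z = n, where x, y, z vanish on [s], on the side
   following [s] and on the side preceding [s].  Then (u, (a, b, c)) is
     the upright small triangle  x >= a, y >= b, z >= c          if u = true,
     the inverted one            x <= a+1, y <= b+1, z <= c+1    if u = false. *)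
Definition is_small (x : bool * (nat * nat * nat)) : bool :=
  let: (u, (a, b, c)) := x in a + b + c + (if u then 1 else 2) == n.

Record small := Small { coords :> bool * (nat * nat * nat); _ : is_small coords }.

HB.instance Definition _ := [isSub for coords].
HB.instance Definition _ := [Countable of small by <:].

Definition small_code (x : small) : bool * ('I_n.+1 * 'I_n.+1 * 'I_n.+1) :=
  let: (u, (a, b, c)) := coords x in (u, (inord a, inord b, inord c)).
Definition small_decode (x : bool * ('I_n.+1 * 'I_n.+1 * 'I_n.+1)) :
    option small :=
  let: (u, (a, b, c)) := x in insub (u, (val a, val b, val c)).

Lemma small_codeK : pcancel small_code small_decode.
Proof.
case=> [[u [[a b] c]] Hx]; rewrite /small_code /small_decode /=.
have /= /eqP Hn := Hx; have le_n : a + b + c <= n by rewrite -Hn leq_addr.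
have [le_ab le_c] : a + b <= n /\ c <= n.
  by split; apply: leq_trans le_n; rewrite ?leq_addr ?leq_addl.
have [le_a le_b] : a <= n /\ b <= n.
  by split; apply: leq_trans le_ab; rewrite ?leq_addr ?leq_addl.
rewrite !inordK ?ltnS //.
by rewrite (insubT is_small Hx); congr Some; apply: val_inj.
Qed.

HB.instance Definition _ : isFinite small := PCanIsFinite small_codeK.

Definition upright (x : small) : bool := (coords x).1.

(* The same small triangle, seen from the side following [s]. *)
Definition cycle_coords (x : bool * (nat * nat * nat)) :=
  let: (u, (a, b, c)) := x in (u, (b, c, a)).

Lemma is_small_cycle x : is_small x -> is_small (cycle_coords x).
Proof. by case: x => u [[a b] c]; rewrite /is_small /= (addnC _ a) addnA. Qed.

Definition cycle_small (x : small) : small :=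
  Small (is_small_cycle (valP x)).

Lemma cycle_small3 x : cycle_small (cycle_small (cycle_small x)) = x.
Proof. by case: x => [[u [[a b] c]] Hx]; apply: val_inj. Qed.

(* The small triangle has a side on [s]. *)
Definition on_side (x : small) : bool :=
  let: (u, (a, b, c)) := coords x in u && (a == 0).

(* The neighbour of the small triangle across its side parallel to [s].  If
   the latter is contained in [s], the neighbour lies in another triangle, and
   its coordinates are those relative to [glue s], the endpoints of which are
   those of [s] exchanged. *)
Definition cross_coords (x : bool * (nat * nat * nat)) :=
  match x with
  | (true, (a.+1, b, c)) => (false, (a, b, c))
  | (true, (0, b, c)) => (true, (0, c, b))
  | (false, (a, b, c)) => (true, (a.+1, b, c))
  end.

Lemma is_small_cross x : is_small x -> is_small (cross_coords x).
Proof.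
case: x => [[] [[[|a] b] c]]; rewrite /is_small /=.
- by rewrite !add0n (addnC c).
- by rewrite addn2 addn1 !addSn.
- by rewrite addn2 addn1 !addSn.
- by rewrite addn2 addn1 !addSn.
Qed.

Definition cross_small (x : small) : small := Small (is_small_cross (valP x)).

Lemma cross_smallK x : cross_small (cross_small x) = x.
Proof. by case: x => [[[] [[[|a] b] c]] Hx]; apply: val_inj. Qed.

Lemma on_side_cross x : on_side (cross_small x) = on_side x.
Proof. by case: x => [[[] [[[|a] b] c]] Hx]. Qed.

Lemma upright_cross x :
  upright (cross_small x) = if on_side x then upright x else ~~ upright x.
Proof. by case: x => [[[] [[[|a] b] c]] Hx]. Qed.

End SmallTriangles.

Section Subdivide.
Variables (n : nat) (G : ribbon).

(* The dart ([s], [x]) goes from the small triangle [x], with its coordinates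
   relative to [s], across its side parallel to [s]. *)
Let sdart : finType := (dart G * small n)%type.

Definition sub_rot_fun (d : sdart) : sdart := (rot G d.1, cycle_small d.2).
Definition sub_opp_fun (d : sdart) : sdart :=
  (if on_side d.2 then opp G d.1 else d.1, cross_small d.2).
Definition sub_white (d : sdart) : bool :=
  if upright d.2 then white d.1 else ~~ white d.1.

Lemma sub_rot_fun3 d : sub_rot_fun (sub_rot_fun (sub_rot_fun d)) = d.
Proof. by case: d => d x; rewrite /sub_rot_fun /= rot3 cycle_small3. Qed.

Lemma sub_rot_inj : injective sub_rot_fun.
Proof.
by apply: (can_inj (g := fun d => sub_rot_fun (sub_rot_fun d))) => d;
  apply: sub_rot_fun3.
Qed.

Lemma sub_opp_funK : involutive sub_opp_fun.
Proof.
case=> d x; rewrite /sub_opp_fun /= on_side_cross cross_smallK.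
by case: (on_side x); rewrite ?oppK.
Qed.

Definition sub_rot : {perm sdart} := perm sub_rot_inj.
Definition sub_opp : {perm sdart} := perm (inv_inj sub_opp_funK).

Lemma sub_rot3 d : sub_rot (sub_rot (sub_rot d)) = d.
Proof. by rewrite !permE sub_rot_fun3. Qed.

Lemma sub_rot_neq d : sub_rot d != d.
Proof. by rewrite permE -pair_eqE /= negb_and rot_neq. Qed.

Lemma sub_oppK d : sub_opp (sub_opp d) = d.
Proof. by rewrite !permE sub_opp_funK. Qed.

Lemma sub_white_rot d : sub_white (sub_rot d) = sub_white d.
Proof.
by rewrite permE /sub_white /= white_rot; case: d => d [[u [[a b] c]] Hx].
Qed.

Lemma sub_white_opp d : sub_white (sub_opp d) = ~~ sub_white d.
Proof.
rewrite permE /sub_white /= upright_cross.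
by case: (on_side d.2); case: (upright d.2); rewrite ?white_opp ?negbK.
Qed.

Definition subdivide : ribbon :=
  @Ribbon sdart sub_rot sub_opp sub_white sub_rot3 sub_rot_neq sub_oppK
    sub_white_rot sub_white_opp.

(* The zig-zag paths of the subdivision that run parallel to the zig-zag path
   [z] of [G]: they cross the same sides, in the same direction. *)
Definition band (z : {set dart G}) : {set {set dart subdivide}} :=
  [set c in zigzags subdivide |
     [exists d : sdart, [&& d \in c, on_side d.2 & d.1 \in z]]].

End Subdivide.

Definition graph_n (n : nat) (T : triangulation) (w : side T -> bool)
    (Hw : bicolouring w) : ribbon :=
  subdivide n (conjugate (dual_graph Hw)).

(* By [zz_conjugate], the puncture [p i] (a set of sides of [T], all starting
   at that puncture) is, as a set of darts, also the zig-zag path of G that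
   corresponds to it. *)
Definition band_labelling (n k : nat) (T : triangulation) (w : side T -> bool)
    (Hw : bicolouring w) (p : 'I_k -> {set side T})
    (zeta : 'I_k -> 'I_n -> {set dart (graph_n n Hw)}) : Prop :=
  forall i : 'I_k, injective (zeta i) /\
    [set zeta i j | j : 'I_n] = @band n (conjugate (dual_graph Hw)) (p i).

Local Open Scope ring_scope.

Record space (K : fieldType) := Space {
  point : Type;
  regular : (point -> K) -> Prop }.

Definition isomorphic (K : fieldType) (X Y : space K) : Prop :=
  exists phi : point X -> point Y, bijective phi /\
    forall f : point Y -> K, regular f <-> regular (f \o phi).

(* The torus (K^* )^I; its regular functions are the Laurent polynomials. *)
Definition torus_point (K : fieldType) (I : finType) : Type :=
  {x : {ffun I -> K} | forall i, x i != 0}.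

Definition laurent (K : fieldType) (I : finType) (f : torus_point K I -> K) :
    Prop :=
  exists s : seq (K * {ffun I -> int}), forall x : torus_point K I,
    f x = \sum_(t <- s) t.1 * \prod_i (sval x i) ^ (t.2 i).

Definition torus (K : fieldType) (I : finType) : space K :=
  Space (@laurent K I).

Definition subspace (K : fieldType) (X : space K) (P : point X -> Prop) :
    space K :=
  @Space K {x : point X | P x}
    (fun f => exists2 h : point X -> K, regular h & forall x, f x = h (sval x)).

(* Quotient by an equivalence relation [e]: the points are the equivalence
   classes, the regular functions are the [e]-invariant regular functions. *)
Definition eqclass (X : Type) (e : X -> X -> Prop) : Type :=
  {c : X -> Prop | exists x, c = e x}.

Definition to_eqclass (X : Type) (e : X -> X -> Prop) (x : X) : eqclass e :=
  exist _ (e x) (ex_intro _ x erefl).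

Definition quotient_space (K : fieldType) (X : space K)
    (e : point X -> point X -> Prop) : space K :=
  @Space K (eqclass e) (fun f => regular (fun x => f (to_eqclass e x))).

Section Connections.
Variables (K : fieldType) (G : ribbon).

(* In chosen bases of the lines attached to the vertices, a connection is the
   scalar attached to each oriented edge. *)
Definition connections : space K :=
  @subspace K (torus K (dart G))
    (fun A => forall d, sval A (opp G d) = (sval A d)^-1).

Definition scalar (A : point connections) (d : dart G) : K := sval (sval A) d.

Definition gauge_equiv (A B : point connections) : Prop :=
  exists2 h : {set dart G} -> K, (forall v, h v != 0) &
    forall d, scalar B d = h (vertex (opp G d)) * scalar A d / h (vertex d).

Definition connections_mod_gauge : space K :=
  @quotient_space K connections gauge_equiv.

(* The monodromy along a closed path that follows the darts of [c], once each. *)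
Definition monodromy (A : point connections) (c : {set dart G}) : K :=
  \prod_(d in c) scalar A d.

(* The subspace of the connections modulo gauge, the monodromies of which along
   the closed paths [zeta i j] are the [lam i j]. *)
Definition monodromy_locus (k n : nat) (zeta : 'I_k -> 'I_n -> {set dart G})
    (lam : 'I_k -> 'I_n -> K) : space K :=
  @subspace K connections_mod_gauge (fun c =>
    forall A : point connections, to_eqclass gauge_equiv A = c ->
      forall i j, monodromy A (zeta i j) = lam i j).

End Connections.

(* Main.v *)
From Pilot Require Import Defs.
From mathcomp Require Import all_boot all_order all_algebra all_fingroup.
From mathcomp Require Import reals complex.
From mathcomp Require Import boolp zify ring.
(* Again, so that [rot] and [opp] are those of ribbon graphs. *)
Import Pilot.Defs.
Set Implicit Arguments.
Unset Strict Implicit.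
Unset Printing Implicit Defensive.
Import Order.TTheory GRing.Theory Num.Theory.

(** Existence. A triangulation with properly coloured triangles amounts to two
    permutations [a] and [b] of its set of edges, with all cycles of length 3
    (the white and the black triangles); the vertices are the cycles of [b * a].
    Inserting a white and a black triangle along an edge multiplies [b * a] by
    two transpositions, apart from adding three points, and so changes the number
    of vertices by one, in either direction if the edge joins two vertices:
    [insert_disc] adds a puncture, [insert_handle] exchanges a puncture for a
    handle. Both increase [2g - 2 + k] by one, and all [(g, k)] are reached from
    the sphere with three punctures and the torus with one ([gluing_exists]).

    Zig-zag paths. In the subdivided graph, a zig-zag path runs along a strip of
    a large triangle and leaves it through one of its sides; where it crosses the
    next side, it does so at the place with the same number. Hence the zig-zag
    paths of the subdivided graph correspond to pairs of a zig-zag path of the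
    original graph and one of [n] strips along it ([zz_subdivide_porbit]).

    Monodromies. Connections are the points of a torus, with one coordinate for
    each edge. The monodromies along the zig-zag paths and the gauge
    transformations are given by integer matrices [B] and [P], the cellular
    boundary and coboundary of the closed surface obtained by gluing a disc to
    each zig-zag path: so [B P^T = 0] ([incidence_orthogonal]). The surface is
    connected, so any two faces are joined by crossing edges and any two vertices
    by following edges; that is why a combination of the rows of [B], or of [P],
    is divisible by an integer only if its coefficients are congruent to each
    other for this modulus ([incidence_primitive]). For the
    modulus zero this says that the only relation between the monodromies is that
    their product is one ([monodromy_relations]). For all moduli together, it says
    that without one row [B] and [P] span direct summands of the lattice of
    exponents, so that a basis of the lattice consists of the rows of [B], of a
    dual basis to the rows of [P], and of [N] further vectors orthogonal to [P]
    ([primitive_complex]). The corresponding monomials are coordinates: the first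
    are prescribed, the second are killed by gauge transformations, and the last
    identify the quotient with a torus of dimension [N] ([locus_isomorphic_torus]).
    Counting edges, vertices and zig-zag paths of the subdivided graph gives
    [N = 3mn^2 - (2mn^2 - 1) - (kn - 1)] with [m = 2g - 2 + k]. *)

(** * Cycles of a permutation *)

Section Cycles.
Variable T : finType.
Implicit Types (s : {perm T}) (x y : T).

Lemma porbit_step s x : porbit s (s x) = porbit s x.
Proof. exact: (porbit_perm s 1 x). Qed.

Lemma porbit_invar (U : Type) s (f : T -> U) x y :
  (forall z, f (s z) = f z) -> y \in porbit s x -> f y = f x.
Proof.
move=> fs /porbitP[i ->]; elim: i => [|i IHi]; first by rewrite perm1.
by rewrite expgSr permM fs.
Qed.

Lemma porbit_closed s (A : pred T) x y :
  (forall z, A (s z) = A z) -> A x -> ~~ A y -> x \notin porbit s y.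
Proof. by move=> As Ax nAy; apply: contra nAy => /(porbit_invar As) <-. Qed.

Lemma porbits_inP s (c : {set T}) :
  reflect (exists x, c = porbit s x) (c \in porbits s).
Proof.
apply: (iffP imsetP) => [[x _ ->]|[x ->]]; first by exists x.
by exists x.
Qed.

Lemma mem_porbits s (c : {set T}) x :
  c \in porbits s -> x \in c -> c = porbit s x.
Proof.
by move=> /porbits_inP[y ->] xy; apply/eqP; rewrite eq_sym eq_porbit_mem.
Qed.

Lemma card_porbits_uniform s k :
  (forall x, #|porbit s x| = k) -> #|T| = #|porbits s| * k.
Proof.
move=> sk; rewrite -cardsT.
apply: card_uniform_partition => [A /imsetP[x _ ->]//|].
apply/and3P; split.
- apply/eqP/setP => x; rewrite !inE; apply/bigcupP.
  by exists (porbit s x); [apply: imset_f | apply: porbit_id].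
- apply/trivIsetP => _ _ /imsetP[x _ ->] /imsetP[y _ ->] nxy.
  apply/pred0P => z /=; apply/negbTE/negP => /andP[zx zy].
  by move: nxy zx zy; rewrite -!eq_porbit_mem => /eqP nxy /eqP zx /eqP zy;
     apply: nxy; rewrite -zx.
- by apply/negP => /imsetP[x _ /setP/(_ x)]; rewrite inE porbit_id.
Qed.

Lemma card_porbits_order2 s :
  (forall x, s (s x) = x) -> (forall x, s x != x) -> #|T| = #|porbits s| * 2.
Proof.
move=> s2 sN; apply: card_porbits_uniform => x.
suff -> : porbit s x = [set x; s x] by rewrite cards2 eq_sym sN.
apply/setP => y; rewrite !inE; apply/idP/idP; last first.
  by case/orP => /eqP->; rewrite ?porbit_id // (mem_porbit s 1).
pose f z := (z == x) || (z == s x).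
have fs z : f (s z) = f z.
  by rewrite /f -{1}(s2 x) !(inj_eq perm_inj) orbC.
by move/(porbit_invar fs) => fE; suff: f y by []; rewrite fE /f eqxx.
Qed.

Lemma card_porbits_order3 s :
  (forall x, s (s (s x)) = x) -> (forall x, s x != x) ->
  #|T| = #|porbits s| * 3.
Proof.
move=> s3 sN; apply: card_porbits_uniform => x.
have n2 : s (s x) != x by apply: contraNneq (sN x) => e; rewrite -{2}(s3 x) e.
have -> : porbit s x = [set x; s x; s (s x)].
  apply/setP => y; rewrite !inE; apply/idP/idP; last first.
    case/orP => [/orP[]|] /eqP->; rewrite ?porbit_id ?(mem_porbit s 1) //.
    by rewrite -eq_porbit_mem !porbit_step.
  pose f z := [|| z == x, z == s x | z == s (s x)].
  move/(porbit_invar (f := f)) => fE; suff: f y by rewrite /f orbA.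
  rewrite fE /f ?eqxx // => z; rewrite -{1}(s3 x) !(inj_eq perm_inj).
  by rewrite orbC -orbA.
rewrite -setUA cardsU1 cards2 !inE negb_or (inj_eq perm_inj).
by rewrite !(eq_sym x) sN n2.
Qed.

End Cycles.

(** A first return map: [r] follows [s] until it meets the image of [e], and
    [s'] is the permutation that [s] induces there. *)
Section Return.
Variables (T U : finType) (s : {perm T}) (s' : {perm U}).
Variables (r : T -> U) (e : U -> T).
Hypothesis eK : cancel e r.
Hypothesis er : forall x, e (r x) \in porbit s x.
Hypothesis rs : forall x, r (s x) \in porbit s' (r x).
Hypothesis es : forall u, e (s' u) \in porbit s (e u).

Lemma return_porbit x y : (y \in porbit s x) = (r y \in porbit s' (r x)).
Proof.
apply/idP/idP => [|sxy].
  move/(porbit_invar (f := fun z => porbit s' (r z))) => <-.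
    exact: porbit_id.
  by move=> z; apply/eqP; rewrite eq_porbit_mem.
have: porbit s (e (r y)) = porbit s (e (r x)).
  apply: (porbit_invar (f := fun z => porbit s (e z))) sxy => z.
  by apply/eqP; rewrite eq_porbit_mem.
have E z : porbit s (e (r z)) = porbit s z by apply/eqP; rewrite eq_porbit_mem.
by rewrite !E => /eqP; rewrite eq_porbit_mem.
Qed.

Lemma return_card : #|porbits s| = #|porbits s'|.
Proof.
suff -> : porbits s' = (fun c : {set T} => [set u | e u \in c]) @: porbits s.
  rewrite card_in_imset // => _ _ /imsetP[x _ ->] /imsetP[y _ ->] /setP/(_ (r x)).
  rewrite !inE er return_porbit eK => /esym; rewrite -return_porbit.
  by rewrite -eq_porbit_mem => /eqP.
have E x : [set u | e u \in porbit s x] = porbit s' (r x).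
  by apply/setP => u; rewrite inE return_porbit eK.
apply/setP => c; apply/imsetP/imsetP => [[u _ ->]|[_ /imsetP[x _ ->] ->]].
  by exists (porbit s (e u)); rewrite ?imset_f // E eK.
by exists (r x) => //; rewrite E.
Qed.

End Return.

(** * Bicoloured triangulations of all surfaces *)

Section DirectSum.
Variables (E F : finType) (s : {perm E}) (t : {perm F}).

Let sum_fun (z : E + F) : E + F :=
  match z with inl x => inl (s x) | inr y => inr (t y) end.

Lemma sum_fun_inj : injective sum_fun.
Proof. by case=> x [] y //= [] /perm_inj ->. Qed.

Definition perm_sum : {perm E + F} := perm sum_fun_inj.

Lemma perm_suml x : perm_sum (inl x) = inl (s x).
Proof. by rewrite permE. Qed.

Lemma perm_sumr y : perm_sum (inr y) = inr (t y).
Proof. by rewrite permE. Qed.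

Lemma card_porbits_sum : #|porbits perm_sum| = #|porbits s| + #|porbits t|.
Proof.
have El x : porbit perm_sum (inl x) = inl @: porbit s x.
  have Ei i : (perm_sum ^+ i)%g (inl x) = inl ((s ^+ i)%g x).
    by elim: i => [|i IHi]; rewrite ?perm1 // !expgSr !permM IHi perm_suml.
  apply/setP => z; apply/porbitP/imsetP => [[i ->]|[_ /porbitP[i ->] ->]].
    by rewrite Ei; exists ((s ^+ i)%g x); rewrite ?mem_porbit.
  by exists i.
have Er y : porbit perm_sum (inr y) = inr @: porbit t y.
  have Ei i : (perm_sum ^+ i)%g (inr y) = inr ((t ^+ i)%g y).
    by elim: i => [|i IHi]; rewrite ?perm1 // !expgSr !permM IHi perm_sumr.
  apply/setP => z; apply/porbitP/imsetP => [[i ->]|[_ /porbitP[i ->] ->]].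
    by rewrite Ei; exists ((t ^+ i)%g y); rewrite ?mem_porbit.
  by exists i.
pose L := (fun A : {set E} => (inl @: A : {set E + F})).
pose R := (fun A : {set F} => (inr @: A : {set E + F})).
have -> : porbits perm_sum = L @: porbits s :|: R @: porbits t.
  apply/setP => c; rewrite inE; apply/imsetP/orP => [[[x|y] _ ->]|].
  - by left; rewrite El; apply: imset_f; apply: imset_f.
  - by right; rewrite Er; apply: imset_f; apply: imset_f.
  case=> /imsetP[_ /imsetP[x _ ->] ->].
  - by exists (inl x).
  - by exists (inr x).
have inlI : injective (@inl E F) by move=> x y [].
have inrI : injective (@inr E F) by move=> x y [].
rewrite cardsU (card_imset _ (imset_inj inlI)) (card_imset _ (imset_inj inrI)).
rewrite (_ : _ :&: _ = set0) ?cards0 ?subn0 //.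
apply/setP => c; rewrite !inE; apply/negbTE/negP => /andP[].
move=> /imsetP[_ /imsetP[x _ ->] ->] /imsetP[_ /imsetP[y _ ->]] /setP/(_ (inl x)).
by rewrite /L imset_f ?porbit_id // => /esym/imsetP[].
Qed.

End DirectSum.

(** Let [E] be the set of edges of a triangulation with properly coloured
    triangles. Each edge has a white and a black side, so that the white
    triangles are the cycles of a permutation [a] of [E] and the black ones
    those of a permutation [b]; the edges whose white sides start at a given
    vertex form a cycle of [b * a]. *)
Definition gluing (E : finType) (a b : {perm E}) : Prop :=
  [/\ forall x, a (a (a x)) = x, forall x, a x != x,
      forall x, b (b (b x)) = x, forall x, b x != x
    & forall f : E -> bool, (forall x, f (a x) = f x) ->
        (forall x, f (b x) = f x) -> forall x y, f x = f y].

Definition cyc3 : {perm 'I_3} := perm (@addIr _ (1%R : 'I_3)).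

Lemma cyc3_cube i : cyc3 (cyc3 (cyc3 i)) = i.
Proof. by rewrite !permE; apply: val_inj; case: i => [[|[|[|]]]]. Qed.

Lemma cyc3_neq i : cyc3 i != i.
Proof. by rewrite permE; case: i => [[|[|[|]]]]. Qed.

Lemma cyc3V_cube i : (cyc3^-1)%g ((cyc3^-1)%g ((cyc3^-1)%g i)) = i.
Proof. by rewrite -[in LHS](cyc3_cube i) !permK. Qed.

Lemma cyc3V_neq i : (cyc3^-1)%g i != i.
Proof. by rewrite -(inj_eq (@perm_inj _ cyc3)) permKV eq_sym cyc3_neq. Qed.

Lemma cyc3_trans (f : 'I_3 -> bool) :
  (forall i, f (cyc3 i) = f i) -> forall i j, f i = f j.
Proof.
move=> fc; suff f0 i : f i = f ord0 by move=> i j; rewrite !f0.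
have c0 : cyc3 ord0 = @Ordinal 3 1 isT by rewrite permE; apply: val_inj.
have c1 : cyc3 (@Ordinal 3 1 isT) = @Ordinal 3 2 isT.
  by rewrite permE; apply: val_inj.
case: i => [[|[|[|]]]] //= Hi.
- by congr f; apply: val_inj.
- by rewrite -(fc ord0) c0; congr f; apply: val_inj.
- by rewrite -(fc ord0) c0 -(fc (@Ordinal 3 1 isT)) c1; congr f; apply: val_inj.
Qed.

Lemma card_porbits1 (F : finType) : #|porbits (1 : {perm F})%g| = #|F|.
Proof.
apply/esym/eqP; rewrite -[X in _ == X]muln1; apply/eqP.
apply: card_porbits_uniform => x.
apply/eqP/cards1P; exists x; apply/setP => y; rewrite inE.
apply/idP/eqP => [|->]; last exact: porbit_id.
by move/(porbit_invar (f := id)) => -> // z; rewrite perm1.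
Qed.

Lemma card_porbits_cyc3_sq : #|porbits (cyc3 * cyc3)%g| = 1.
Proof.
apply/eqP; rewrite -(eqn_pmul2r (m := 3)) //.
rewrite -card_porbits_order3 ?card_ord // => i.
  by rewrite !permM !cyc3_cube.
by rewrite permM -(inj_eq (@perm_inj _ cyc3)) cyc3_cube eq_sym cyc3_neq.
Qed.

(** Cutting the surface open along the edge [e] and filling the slit with a
    white and a black triangle, the remaining sides of which are glued in pairs.
    The new edges are the elements of ['I_3]; [ord0] is the black side of the
    slit and [e] itself becomes the white one. The pairing is given by [d], equal
    to [cyc3] or to its inverse: the latter fills the slit with a disc that has
    one inner vertex, the former merges the two ends of [e]. *)
Section Insertion.
Variables (E : finType) (a b : {perm E}) (e : E) (d : {perm 'I_3}).
Hypothesis Hab : gluing a b.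
Hypothesis d3 : forall i, d (d (d i)) = i.
Hypothesis dN : forall i, d i != i.

Let t : {perm E + 'I_3} := tperm (inl e) (inr ord0).
Definition insert_white : {perm E + 'I_3} := perm_sum a cyc3.
Definition insert_black : {perm E + 'I_3} := (t * perm_sum b d * t)%g.

Let blackE z : insert_black z = t (perm_sum b d (t z)).
Proof. by rewrite !permM. Qed.

Lemma insert_gluing : gluing insert_white insert_black.
Proof.
have [a3 aN b3 bN abT] := Hab; split.
- by case=> x; rewrite ?(perm_suml, perm_sumr) ?a3 ?cyc3_cube.
- case=> x; rewrite ?(perm_suml, perm_sumr).
    by apply/eqP => -[] /eqP; rewrite (negbTE (aN x)).
  by apply/eqP => -[] /eqP; rewrite (negbTE (cyc3_neq x)).
- have s3 z : perm_sum b d (perm_sum b d (perm_sum b d z)) = z.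
    by case: z => x; rewrite ?(perm_suml, perm_sumr) ?b3 ?d3.
  by move=> z; rewrite !blackE !tpermK s3 tpermK.
- have sN z : perm_sum b d z != z.
    case: z => x; rewrite ?(perm_suml, perm_sumr).
      by apply/eqP => -[] /eqP; rewrite (negbTE (bN x)).
    by apply/eqP => -[] /eqP; rewrite (negbTE (dN x)).
  move=> z; rewrite blackE; apply/eqP => /(congr1 t); rewrite tpermK => /eqP.
  by rewrite (negbTE (sN _)).
move=> f fw fb.
have fr i : f (inr i) = f (inr ord0).
  apply: (cyc3_trans (f := fun i => f (inr i))) => j.
  by rewrite -(perm_sumr a) fw.
have fe : f (inl e) = f (inr ord0).
  rewrite -fb blackE tpermL perm_sumr tpermD ?fr //.
  by apply/eqP => -[] /eqP; rewrite eq_sym (negbTE (dN _)).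
have ft z : f (t z) = f z by rewrite /t; case: tpermP => [->|->|].
have fl x : f (inl x) = f (inl e).
  apply: (abT (fun x => f (inl x))) => y; first by rewrite -(perm_suml a cyc3) fw.
  rewrite -(perm_suml b d) -ft -{1}[inl y](tpermK (inl e) (inr ord0)) -blackE.
  by rewrite fb ft.
have f0 z : f z = f (inr ord0) by case: z => z; rewrite ?fl ?fr.
by move=> x y; rewrite !f0.
Qed.

Let t' : {perm E + 'I_3} := tperm (inl ((b^-1)%g e)) (inr ((d^-1)%g ord0)).
Let k : {perm E + 'I_3} := perm_sum (b * a)%g (d * cyc3)%g.

(** Conjugating the transposition of the two black sides by the rotation of the
    black triangles turns the vertex permutation into that of two disjoint pieces
    composed with two transpositions. *)
Let vertexE : (insert_black * insert_white = t * (t' * k))%g.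
Proof.
apply/permP => z; rewrite !permM; move: (t z) => {}z.
have kE u : k u = insert_white (perm_sum b d u).
  by case: u => u; rewrite ?(perm_suml, perm_sumr) permM.
rewrite kE; congr (insert_white _).
rewrite /t /t'; case: (tpermP (inl _) _ z) => [->|->|nz1 nz2].
- by rewrite perm_suml permKV tpermL perm_sumr permKV.
- by rewrite perm_sumr permKV tpermR perm_suml permKV.
by apply: tpermD; apply/eqP;
  [move=> ze; apply: nz1 | move=> ze; apply: nz2];
  apply: (@perm_inj _ (perm_sum b d)); rewrite -ze ?(perm_suml, perm_sumr) permKV.
Qed.

Lemma card_insert_vertices :
  (inl e) \notin porbit (t' * k)%g (inr ord0) ->
  #|porbits (insert_black * insert_white)%g| + 2
    = #|porbits (b * a)%g| + #|porbits (d * cyc3)%g|.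
Proof.
move=> ne; rewrite vertexE; have := porbits_mul_tperm (t' * k) (inl e) (inr ord0).
have := porbits_mul_tperm k (inl ((b^-1)%g e)) (inr ((d^-1)%g ord0)).
pose is_left (z : E + 'I_3) := if z is inl _ then true else false.
rewrite /= -/t -/t' ne card_porbits_sum (porbit_closed (A := is_left)) //.
  by move=> ku tu; rewrite [LHS]tu; apply: (@addIn 1); rewrite -addnA [LHS]ku.
by case=> z; rewrite ?(perm_suml, perm_sumr).
Qed.

End Insertion.

(** The new inner vertex is the cycle reduced to the point [inr ord0]. *)
Lemma insert_disc (E : finType) (a b : {perm E}) (e : E) :
  #|porbits (insert_black b e cyc3^-1 * insert_white a)%g|
    = #|porbits (b * a)%g| + 1.
Proof.
have := card_insert_vertices (b := b) (e := e) (d := cyc3^-1%g) (a := a).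
rewrite mulVg card_porbits1 card_ord.
set P := (_ \notin _); suff -> : P by move=> /(_ isT); lia.
rewrite {}/P.
apply: (porbit_closed (A := fun z => z != inr ord0)) => // z.
congr negb; set s := (_ * _)%g; suff {1}<- : s (inr ord0) = inr ord0.
  exact: (inj_eq (@perm_inj _ s)).
rewrite permM tpermD ?perm_sumr ?perm1 //.
by apply/eqP => -[] /eqP; rewrite invgK (negbTE (cyc3_neq _)).
Qed.

(** The two ends of [e] are the cycles of [e] and of [b^-1 e]. When they are
    distinct, one vertex is lost, which means that the genus increases. *)
Lemma insert_handle (E : finType) (a b : {perm E}) (e : E) :
  e \notin porbit (b * a)%g ((b^-1)%g e) ->
  #|porbits (insert_black b e cyc3 * insert_white a)%g| + 1
    = #|porbits (b * a)%g|.
Proof.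
move=> ne; have := card_insert_vertices (b := b) (e := e) (d := cyc3) (a := a).
rewrite card_porbits_cyc3_sq.
set P := (_ \notin _); suff -> : P by move=> /(_ isT); lia.
rewrite {}/P.
pose A (z : E + 'I_3) :=
  if z is inl x then x \notin porbit (b * a)%g ((b^-1)%g e) else false.
apply: (porbit_closed (A := A)) => //= z; rewrite permM.
have -> u : A (perm_sum (b * a)%g (cyc3 * cyc3)%g u) = A u.
  by case: u => u; rewrite ?(perm_suml, perm_sumr) //= -!eq_porbit_mem porbit_step.
by case: tpermP => [->|->|] //=; rewrite porbit_id.
Qed.

Lemma gluing_exists m g k : 1 <= k -> 2 * g + k = m + 3 ->
  exists (E : finType) (a b : {perm E}),
    [/\ gluing a b, #|porbits (b * a)%g| = k & #|E| = 3 * m.+1].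
Proof.
elim: m g k => [|m IHm] g k k1 gk.
  have G (d : {perm 'I_3}) :
      (forall i, d (d (d i)) = i) -> (forall i, d i != i) -> gluing cyc3 d.
    move=> d3 dN; split=> //; [exact: cyc3_cube | exact: cyc3_neq |].
    by move=> f fc _; apply: cyc3_trans.
  have [g0|g1] : g = 0 \/ g = 1 by lia.
    exists 'I_3, cyc3, (cyc3^-1)%g; split.
    - exact: G cyc3V_cube cyc3V_neq.
    - by rewrite mulVg card_porbits1 card_ord; lia.
    - by rewrite card_ord.
  exists 'I_3, cyc3, cyc3; split; last by rewrite card_ord.
    exact: G cyc3_cube cyc3_neq.
  by rewrite card_porbits_cyc3_sq; lia.
have cardE (E : finType) : #|E| = 3 * m.+1 -> #|{: E + 'I_3}| = 3 * m.+2.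
  by move=> cE; rewrite card_sum card_ord cE; lia.
have [k2|k2] := leqP 2 k.
  have [||E [a [b [Hab cv cE]]]] := IHm g k.-1; try lia.
  have /card_gt0P[e _] : 0 < #|E| by rewrite cE.
  exists (E + 'I_3)%type, (insert_white a), (insert_black b e cyc3^-1).
  split; [exact: insert_gluing Hab cyc3V_cube cyc3V_neq | | exact: cardE].
  by rewrite insert_disc // cv; lia.
have [||E [a [b [Hab cv cE]]]] := IHm g.-1 2; try lia.
(* For [k = 1], start from a triangulation with two vertices: they are joined by
   some edge, as the surface is connected, and a handle there merges them. *)
have [e ne] : exists e, e \notin porbit (b * a)%g ((b^-1)%g e).
  apply/existsP; rewrite -[X in is_true X]negbK negb_exists; apply/negP.
  move=> /forallP all_in.
  have Pb x : porbit (b * a)%g (b x) = porbit (b * a)%g x.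
    have := all_in (b x); rewrite negbK permK -eq_porbit_mem => /eqP.
    by [].
  have Pa x : porbit (b * a)%g (a x) = porbit (b * a)%g x.
    by rewrite -{1}[x](permKV b) -permM porbit_step -Pb permKV.
  have [_ _ _ _ abT] := Hab.
  have one x y : porbit (b * a)%g x = porbit (b * a)%g y.
    pose f z := porbit (b * a)%g z == porbit (b * a)%g x.
    apply/eqP; rewrite eq_sym -/(f y) -(abT f _ _ x y) /f ?eqxx // => z.
      by rewrite Pa.
    by rewrite Pb.
  have: #|porbits (b * a)%g| <= 1.
    have /card_gt0P[x _] : 0 < #|E| by rewrite cE.
    rewrite -(cards1 (porbit (b * a)%g x)); apply/subset_leq_card/subsetP.
    by move=> _ /imsetP[y _ ->]; rewrite inE (one y x).
  by rewrite cv.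
exists (E + 'I_3)%type, (insert_white a), (insert_black b e cyc3).
split; [exact: insert_gluing Hab cyc3_cube cyc3_neq | | exact: cardE].
by have := insert_handle (e := e) ne; rewrite cv; lia.
Qed.

Section GluingTriangulation.
Variables (E : finType) (a b : {perm E}).
Hypothesis Hab : gluing a b.

(** The side [(true, e)] is the white side of the edge [e], [(false, e)] the
    black one. *)
Let gside : finType := (bool * E)%type.

Let next_fun (s : gside) : gside := (s.1, if s.1 then a s.2 else b s.2).
Let glue_fun (s : gside) : gside := (~~ s.1, s.2).

Let next_fun_inj : injective next_fun.
Proof. by case=> -[] x [] [] y //= [] /perm_inj ->. Qed.

Let glue_fun_inj : injective glue_fun.
Proof. by case=> -[] x [] [] y //= [] ->. Qed.

Let gnext : {perm gside} := perm next_fun_inj.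
Let gglue : {perm gside} := perm glue_fun_inj.

Let gnext3 s : gnext (gnext (gnext s)) = s.
Proof.
have [a3 _ b3 _ _] := Hab.
by case: s => -[] x; rewrite !permE /next_fun /= ?a3 ?b3.
Qed.

Let gnext_neq s : gnext s != s.
Proof.
have [_ aN _ bN _] := Hab; rewrite permE; apply/eqP.
by case: s => -[] x [] /eqP; rewrite ?(negbTE (aN _)) ?(negbTE (bN _)).
Qed.

Let gglueK s : gglue (gglue s) = s.
Proof. by case: s => c x; rewrite !permE /glue_fun /= negbK. Qed.

Let gglue_neq s : gglue s != s.
Proof. by rewrite permE; case: s => -[] x. Qed.

Let gconnected s u : connect [rel x y | (y == gnext x) || (y == gglue x)] s u.
Proof.
set R := [rel _ _ | _]; have [_ _ _ _ abT] := Hab.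
have Rn x : connect R x (gnext x) by apply: connect1; rewrite /= eqxx.
have Rg x : connect R x (gglue x) by apply: connect1; rewrite /= eqxx orbT.
pose f x := connect R s x.
have fn x : f (gnext x) = f x.
  apply/idP/idP => fx; last exact: connect_trans fx (Rn _).
  rewrite -(gnext3 x); do 2 (apply: (connect_trans _ (Rn _))).
  exact: fx.
have fg x : f (gglue x) = f x.
  apply/idP/idP => fx; last exact: connect_trans fx (Rg _).
  by rewrite -(gglueK x); apply: (connect_trans fx).
have fc c x : f (c, x) = f (true, x).
  by case: c => //; rewrite -(fg (true, x)) permE.
suff -> : connect R s u = f s by apply: connect0.
rewrite -/(f u) [u]surjective_pairing [in RHS]/f -/(f s) [s]surjective_pairing.
rewrite !fc.
apply: (abT (fun x => f (true, x))) => x; first by rewrite -(fn (true, x)) permE.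
by rewrite -(fc false) -(fc false x) -(fn (false, x)) permE.
Qed.

Definition gluing_triangulation : triangulation :=
  @Triangulation gside gnext gglue gnext3 gnext_neq gglueK gglue_neq gconnected.

Lemma gluing_bicolouring :
  @bicolouring gluing_triangulation (fun s : gside => s.1).
Proof. by split=> s; rewrite /= permE. Qed.

Lemma card_gluing_vertices :
  #|vertices gluing_triangulation| = #|porbits (b * a)%g|.
Proof.
have step s : (gglue * gnext)%g s = (~~ s.1, if s.1 then b s.2 else a s.2).
  by rewrite permM !permE; case: s => -[].
(* [glue * next] exchanges colours, so its cycles are those of its first return
   to the white sides. *)
pose r (s : gside) := if s.1 then s.2 else a s.2.
apply: (@return_card _ _ _ _ r (fun e : E => (true, e))) => //=.
- case=> -[] x; first exact: porbit_id.
  by rewrite -eq_porbit_mem -(porbit_step _ (false, x)) step.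
- case=> -[] x; rewrite step /r /= ?porbit_id //.
  by rewrite -eq_porbit_mem -(porbit_step _ x) permM.
- move=> x; rewrite -eq_porbit_mem -(porbit_step _ (true, x)) step /=.
  by rewrite -(porbit_step _ (false, _)) step permM.
Qed.

End GluingTriangulation.

Lemma card_edges (T : triangulation) : #|side T| = #|edges T| * 2.
Proof. by apply: card_porbits_order2; [apply: glueK | apply: glue_neq]. Qed.

Lemma card_triangles (T : triangulation) : #|side T| = #|triangles T| * 3.
Proof. by apply: card_porbits_order3; [apply: next3 | apply: next_neq]. Qed.

Lemma bicoloured_triangulation_exists g k : 1 <= k -> 2 < 2 * g + k ->
  exists (T : triangulation) (p : 'I_k -> {set side T}) (w : side T -> bool),
    triangulates g p /\ bicolouring w.
Proof.
move=> k1 gk.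
have [||E [a [b [Hab cv cE]]]] := @gluing_exists (2 * g + k - 3) g k; try lia.
pose T := gluing_triangulation Hab.
have cvT : #|vertices T| = k by rewrite card_gluing_vertices.
exists T, (fun i => enum_val (cast_ord (esym cvT) i)), (fun s => s.1).
split; last exact: gluing_bicolouring.
split.
- by move=> i j /enum_val_inj /cast_ord_inj.
- apply/setP => c; apply/imsetP/idP => [[i _ ->]|cT]; first exact: enum_valP.
  by exists (cast_ord cvT (enum_rank_in cT c)); rewrite // cast_ordK enum_rankK_in.
have := card_edges T; have := card_triangles T; rewrite cvT.
by rewrite card_prod card_bool cE; lia.
Qed.

(** * The subdivided graph *)

Section SmallTriangleCount.
Variable n : nat.

Let code (ij : 'I_n * 'I_n) : bool * (nat * nat * nat) :=
  if ij.1 <= ij.2 then (true, (ij.2 - ij.1, val ij.1, n.-1 - ij.2))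
  else (false, (ij.1 - ij.2.+1, val ij.2, n.-1 - ij.1)).

Let is_small_code ij : is_small n (code ij).
Proof.
case: ij => i j; have := ltn_ord i; have := ltn_ord j.
by rewrite /is_small /code /=; case: (leqP i j) => /= ? ? ?; apply/eqP; lia.
Qed.

(** The strip [b <= y <= b + 1] of a triangle consists of [n - b] upright and
    [n - b - 1] inverted small triangles. The former are sent above the diagonal
    of the square, to its row [b], the latter below it, to its column [b]. *)
Lemma card_small : #|{: small n}| = n * n.
Proof.
rewrite -[in n * n](card_ord n) -card_prod.
pose f ij := Small (is_small_code ij); have f_inj : injective f.
  move=> [i j] [i' j'] /(congr1 (@coords n)); rewrite /= /code /=.
  have := ltn_ord i; have := ltn_ord j; have := ltn_ord i'; have := ltn_ord j'.
  move=> ? ? ? ?; case: (leqP i j) => ij; case: (leqP i' j') => ij' // [? ? ?];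
    by congr pair; apply: val_inj => /=; lia.
rewrite -(card_codom f_inj); apply/esym/eq_card => x; rewrite [RHS]inE.
apply/codomP; case: x => [[u [[a b] c]] Hx].
have /= /eqP abc := Hx; case: u Hx abc => Hx abc.
  have b_lt : b < n by lia. have ab_lt : a + b < n by lia.
  exists (Ordinal b_lt, Ordinal ab_lt); apply: val_inj => /=.
  by rewrite /code /= leq_addl; congr (_, (_, _, _)); lia.
have b_lt : b < n by lia. have ab_lt : (a + b).+1 < n by lia.
exists (Ordinal ab_lt, Ordinal b_lt); apply: val_inj => /=.
by rewrite /code /= leqNgt ltnS leq_addl /=; congr (_, (_, _, _)); lia.
Qed.

End SmallTriangleCount.

(** Phrased with boolean functions because it is applied to properties of faces
    and vertices, such as the divisibility of a coefficient. *)
Definition ribbon_connected (G : ribbon) : Prop :=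
  forall f : dart G -> bool, (forall d, f (rot G d) = f d) ->
    (forall d, f (opp G d) = f d) -> forall d e, f d = f e.

Lemma dual_graph_connected (T : triangulation) (w : side T -> bool)
  (Hw : bicolouring w) : ribbon_connected (dual_graph Hw).
Proof.
move=> f fr fo s u; have /connectP[q] := side_connected s u.
elim: q s => [|t q IHq] s /= => [_ ->//|/andP[st tq] uq].
rewrite -(IHq t tq uq); case/orP: st => /eqP->; first exact: esym (fr s).
exact: esym (fo s).
Qed.

Lemma twistE (G : ribbon) (d : dart G) :
  twist G d = if white d then rot G d else ((rot G)^-1)%g d.
Proof. by rewrite permE. Qed.

Lemma twist_white (G : ribbon) (d : dart G) : white d -> twist G d = rot G d.
Proof. by rewrite permE /twist_fun => ->. Qed.

Lemma twist_black (G : ribbon) (d : dart G) :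
  ~~ white d -> twist G d = ((rot G)^-1)%g d.
Proof. by rewrite permE /twist_fun => /negbTE ->. Qed.

Lemma rot_invar (G : ribbon) (U : Type) (f : dart G -> U) :
  (forall d, f (twist G d) = f d) -> forall d, f (rot G d) = f d.
Proof.
move=> ft d; case wd: (white d); first by rewrite -(twist_white wd).
by rewrite -ft twist_black ?white_rot ?wd // permK.
Qed.

Lemma conjugate_connected (G : ribbon) :
  ribbon_connected G -> ribbon_connected (conjugate G).
Proof. by move=> Gc f ft fo; apply: Gc => // d; apply: rot_invar. Qed.

Section Subdivision.
Variables (n : nat) (G : ribbon).
Let H : ribbon := subdivide n G.

(** Within a large triangle, passing through an inverted small triangle moves an
    upright one by one step parallel to a side, so that all small triangles are
    joined; those that lie on a side lead to the neighbouring large triangle. *)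
Lemma subdivide_connected : 0 < n -> ribbon_connected G -> ribbon_connected H.
Proof.
move=> n_gt0 Gc f fr fo.
(* The values of [f] as a function of raw coordinates. *)
pose f' s x := if insub x is Some y then f (s, y) else true.
have f'E s (y : small n) : f' s (coords y) = f (s, y) by rewrite /f' valK.
have cyc s x : is_small n x -> f' (rot G s) (cycle_coords x) = f' s x.
  move=> Hx; rewrite (f'E s (Small Hx)) -[RHS]fr [rot H _]permE.
  exact: (f'E _ (cycle_small (Small Hx))).
have crs s x : is_small n x ->
    f' (if x is (true, (0, _, _)) then opp G s else s) (cross_coords x) = f' s x.
  move=> Hx; rewrite (f'E s (Small Hx)) -[RHS]fo [opp H _]permE.
  rewrite /sub_opp_fun -f'E /on_side /=.
  by case: x Hx => [[] [[[|a] b] c]] Hx.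
have fab s a b c : is_small n (true, (a.+1, b, c)) ->
    f' s (true, (a.+1, b, c)) = f' s (true, (a, b.+1, c)).
  move=> Hx; rewrite -(crs s) //= -cyc ?(is_small_cross Hx) //=.
  rewrite -crs /=; last exact: is_small_cycle (is_small_cross Hx).
  rewrite -(cyc s (true, (a, b.+1, c))) //.
  by apply/eqP; move/eqP: Hx => /=; lia.
have fbc s a b c : is_small n (true, (a, b.+1, c)) ->
    f' s (true, (a, b.+1, c)) = f' s (true, (a, b, c.+1)).
  move=> Hx; rewrite -cyc //= fab ?(is_small_cycle Hx) //.
  rewrite -(cyc s (true, (a, b, c.+1))) //.
  by apply/eqP; move/eqP: Hx => /=; lia.
have fup s a b c : is_small n (true, (a, b, c)) ->
    f' s (true, (a, b, c)) = f' s (true, (0, 0, n.-1)).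
  elim: a b c => [|a IHa] b c Hx; last first.
    rewrite fab // IHa //.
    by apply/eqP; move/eqP: Hx => /=; lia.
  elim: b c Hx => [|b IHb] c Hx; last first.
    rewrite fbc // IHb //.
    by apply/eqP; move/eqP: Hx => /=; lia.
  by congr (f' _ (_, (_, _, _))); move/eqP: Hx => /=; lia.
have fdn s a b c : is_small n (false, (a, b, c)) ->
    f' s (false, (a, b, c)) = f' s (true, (0, 0, n.-1)).
  by move=> Hx; rewrite -crs //= fup //; apply: (is_small_cross Hx).
have fE s (y : small n) : f (s, y) = f' s (true, (0, 0, n.-1)).
  rewrite -f'E; case: y => [[u [[a b] c]] Hx] /=.
  by case: u Hx => Hx; [apply: fup | apply: fdn].
have Hz : is_small n (true, (0, 0, n.-1)).
  by rewrite /is_small /= add0n addn1 prednK.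
move=> [s x] [t y]; rewrite !fE.
apply: (Gc (fun s => f' s (true, (0, 0, n.-1)))) => {}s.
  rewrite -(cyc s) //= fup //.
  exact: (is_small_cycle Hz).
rewrite -(crs s) //= fup //.
exact: (is_small_cross Hz).
Qed.

(** Within a triangle a zig-zag path runs along a strip between two lines
    parallel to a side of the triangle. Of the [n] small sides through which it
    may leave the triangle, this is the number of the one that it takes. Upright
    small triangles of a strip have the same [b] in a white large triangle, and
    the same [c] in a black one, where [a + b = n - 1 - c]. *)
Definition exit_strip (d : dart H) : nat :=
  let: (u, (a, b, c)) := coords d.2 in
  if u then (if white d.1 then b else a + b)
  else if white d.1 then c else (a + c).+1.

Definition exit_side (d : dart H) : dart G :=
  if upright d.2 then d.1 else twist G d.1.

Lemma exit_strip_lt d : exit_strip d < n.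
Proof.
case: d => s [[u [[a b] c]] Hx]; rewrite /exit_strip /=.
by move: (Hx) => /eqP /=; case: u {Hx}; case: ifP => _ ?; lia.
Qed.

Lemma is_small_entry (b : 'I_n) : is_small n (true, (0, val b, n.-1 - b)).
Proof. by have := ltn_ord b; rewrite /is_small /=; move=> ?; apply/eqP; lia. Qed.

Definition crossing (s : dart G) (b : 'I_n) : dart H :=
  (s, Small (is_small_entry b)).

Definition exit_index (d : dart H) : 'I_n := Ordinal (exit_strip_lt d).

Lemma exit_side_crossing s b : exit_side (crossing s b) = s.
Proof. by []. Qed.

Lemma exit_index_crossing s b : exit_index (crossing s b) = b.
Proof. by apply: val_inj; rewrite /= /exit_strip /= add0n if_same. Qed.

Lemma crossing_exit d :
  on_side d.2 -> d = crossing (exit_side d) (exit_index d).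
Proof.
case: d => s [[u [[a b] c]] Hx]; rewrite /on_side /=.
case: u Hx => // Hx /eqP a0; subst a; congr pair.
apply: val_inj; rewrite /= /exit_strip /= add0n if_same.
by congr (_, (_, _, _)); move: Hx => /eqP /=; lia.
Qed.

Lemma zz_subdivide (d : dart H) :
  zz H d = if white (opp H d) then rot H (opp H d)
           else ((rot G)^-1%g (opp H d).1,
                 cycle_small (cycle_small (opp H d).2)).
Proof.
rewrite /= permM; case: ifP => we; first exact: (@twist_white H).
rewrite (@twist_black H _ (negbT we)).
have E e : rot H ((rot G)^-1%g e.1, cycle_small (cycle_small e.2)) = e.
  by rewrite permE /sub_rot_fun /= permKV cycle_small3 -surjective_pairing.
by rewrite -{1}(E (opp H d)) permK.
Qed.

(** Decreases along a zig-zag path until it leaves the triangle. *)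
Definition steps_to_exit (d : dart H) : nat :=
  let: (u, (a, b, c)) := coords d.2 in
  if u then a.*2 else (if white d.1 then b else c).*2.+1.

Lemma white_subdivide (d : dart H) :
  white d = if upright d.2 then white d.1 else ~~ white d.1.
Proof. by []. Qed.

Lemma opp_subdivide (d : dart H) :
  opp H d = (if on_side d.2 then opp G d.1 else d.1, cross_small d.2).
Proof. exact: permE. Qed.

Lemma zz_exit_inside d : ~~ on_side d.2 ->
  [/\ exit_side (zz H d) = exit_side d, exit_index (zz H d) = exit_index d
    & steps_to_exit (zz H d) < steps_to_exit d].
Proof.
move=> nd; rewrite zz_subdivide white_subdivide opp_subdivide (negbTE nd) /=.
rewrite upright_cross (negbTE nd) [rot H _]permE /sub_rot_fun /=.
case: d nd => s [[u [[a b] c]] Hx] /=; rewrite /upright /on_side /=.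
have wr : white (rot G s) = white s := white_rot s.
have wv : white ((rot G)^-1%g s) = white s := white_rotV s.
case: u Hx => Hx /= a0; [case: a Hx a0 => // a Hx _ |];
  case ws: (white s);
  rewrite /= /exit_side /exit_index /steps_to_exit /upright /=;
  split; rewrite ?twistE ?wr ?wv ?ws ?permK ?permKV //;
  try (apply: val_inj); rewrite /exit_strip /= ?wr ?wv ?ws; try lia.
Qed.

Lemma zz_exit_cross d : on_side d.2 ->
  exit_side (zz H d) = zz G (exit_side d) /\
  exit_index (zz H d) = exit_index d.
Proof.
move=> yd; rewrite zz_subdivide white_subdivide opp_subdivide yd /=.
rewrite upright_cross yd [rot H _]permE /sub_rot_fun /=.
case: d yd => s [[u [[a b] c]] Hx] /=; rewrite /upright /on_side /=.
case: u Hx => // Hx /eqP a0; subst a => /=.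
have wr d : white (rot G d) = white d := white_rot d.
have wv d : white ((rot G)^-1%g d) = white d := white_rotV d.
rewrite white_opp; case ws: (white s);
  rewrite /= /exit_side /exit_index /upright /= permM;
  split; rewrite ?twistE ?white_opp ?ws //;
  apply: val_inj; rewrite /exit_strip /= ?wr ?wv ?white_opp ?ws /=; lia.
Qed.

Lemma crossing_porbit d :
  crossing (exit_side d) (exit_index d) \in porbit (zz H) d.
Proof.
have [k] := ubnP (steps_to_exit d); elim: k d => // k IHk d.
have [yd _|nd dk] := boolP (on_side d.2).
  by rewrite -crossing_exit // porbit_id.
have [<- <- lt_d] := zz_exit_inside nd.
by rewrite -(porbit_step _ d); apply: IHk; apply: leq_trans lt_d dk.
Qed.

(** A zig-zag path of the subdivided graph is the same thing as a zig-zag path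
    of the graph with one of [n] strips along it: the first return of the
    former to the sides of the large triangles moves along the latter and keeps
    the strip. *)
Lemma zz_subdivide_porbit x y :
  (y \in porbit (zz H) x) =
  (exit_side y \in porbit (zz G) (exit_side x))
    && (exit_index y == exit_index x).
Proof.
apply/idP/andP => [xy|[xy /eqP exy]].
  have inv d : porbit (zz G) (exit_side (zz H d)) = porbit (zz G) (exit_side d)
      /\ exit_index (zz H d) = exit_index d.
    have [yd|nd] := boolP (on_side d.2).
      by have [-> ->] := zz_exit_cross yd; rewrite porbit_step.
    by have [-> -> _] := zz_exit_inside nd.
  split.
    rewrite -eq_porbit_mem; apply/eqP.
    exact: (porbit_invar (fun d => (inv d).1) xy).
  by apply/eqP; apply: (porbit_invar (fun d => (inv d).2) xy).
have step s b : porbit (zz H) (crossing (zz G s) b) = porbit (zz H) (crossing s b).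
  have [e1 e2] := @zz_exit_cross (crossing s b) isT.
  rewrite -(porbit_step _ (crossing s b)); apply/eqP.
  have := crossing_porbit (zz H (crossing s b)).
  by rewrite e1 e2 exit_side_crossing exit_index_crossing -eq_porbit_mem.
pose f s := porbit (zz H) (crossing s (exit_index x)).
have := porbit_invar (f := f) (fun s => step s _) xy; rewrite {}/f.
have E d :
    porbit (zz H) (crossing (exit_side d) (exit_index d)) = porbit (zz H) d.
  by apply/eqP; rewrite eq_porbit_mem crossing_porbit.
by rewrite E -exy E => yx; rewrite -eq_porbit_mem yx.
Qed.

Lemma mem_band (z : {set dart G}) d : z \in zigzags G ->
  (porbit (zz H) d \in band n z) = (exit_side d \in z).
Proof.
move=> /porbits_inP[s ->]; rewrite inE imset_f //=; apply/existsP/idP.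
  case=> e /and3P[]; rewrite zz_subdivide_porbit => /andP[de _] ye.
  have -> : e.1 = exit_side e by rewrite {1}(crossing_exit ye).
  by rewrite -!eq_porbit_mem in de * => /eqP <-; rewrite eq_sym.
move=> ds; exists (crossing (exit_side d) (exit_index d)).
by rewrite crossing_porbit.
Qed.

End Subdivision.

Section BandLabelling.
Variables (n k : nat) (G : ribbon) (p : 'I_k -> {set dart G}).
Hypothesis p_inj : injective p.
Hypothesis p_zigzags : [set p i | i : 'I_k] = zigzags G.
Let H : ribbon := subdivide n G.

Let p_zigzag i : p i \in zigzags G.
Proof. by rewrite -p_zigzags imset_f. Qed.

Let bands_labelled (zeta : 'I_k -> 'I_n -> {set dart H}) : Prop :=
  forall i, injective (zeta i) /\ [set zeta i j | j : 'I_n] = band n (p i).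

Lemma bands_labelled_exists :
  exists zeta : 'I_k -> 'I_n -> {set dart H}, bands_labelled zeta.
Proof.
have /fin_all_exists[s ps] i : exists s, p i = porbit (zz G) s.
  exact/porbits_inP.
exists (fun i j => porbit (zz H) (crossing (s i) j)) => i; split=> [j j' /eqP|].
  rewrite eq_porbit_mem zz_subdivide_porbit !exit_index_crossing.
  by case/andP => _ /eqP.
apply/setP => c; apply/imsetP/idP => [[j _ ->]|].
  by rewrite mem_band // exit_side_crossing ps porbit_id.
move=> cp; have : c \in zigzags H by move: cp; rewrite inE => /andP[].
case/porbits_inP => x cx; move: cp; rewrite cx mem_band // ps => xs.
exists (exit_index x) => //; apply/eqP.
by rewrite eq_porbit_mem zz_subdivide_porbit exit_index_crossing xs eqxx.
Qed.

(** The bands partition the zig-zag paths of the subdivided graph, because those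
    to which they belong partition the darts of the original one. *)
Lemma bands_face (zeta : 'I_k -> 'I_n -> {set dart H}) : bands_labelled zeta ->
  exists face : dart H -> 'I_k * 'I_n,
    [/\ forall d i j, (d \in zeta i j) = (face d == (i, j)),
        forall d, face (zz H d) = face d
      & forall f, exists d, face d = f].
Proof.
move=> zB.
have z_band i j : zeta i j \in band n (p i).
  by have [_ <-] := zB i; apply: imset_f.
have z_zz i j : zeta i j \in zigzags H.
  by have := z_band i j; rewrite inE => /andP[].
have z_inj i j i' j' : zeta i j = zeta i' j' -> (i, j) = (i', j').
  move=> e; have /porbits_inP[x cx] := z_zz i j.
  have xi := z_band i j; have xi' := z_band i' j'.
  rewrite -e in xi'; rewrite cx !mem_band // in xi xi'.
  have ii : i = i'.
    apply: p_inj; rewrite (mem_porbits (p_zigzag i) xi).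
    by rewrite (mem_porbits (p_zigzag i') xi').
  by subst i'; have [zi _] := zB i; rewrite (zi _ _ e).
have /fin_all_exists[face fP] d : exists f, porbit (zz H) d = zeta f.1 f.2.
  have : porbit (zz G) (exit_side d) \in [set p i | i : 'I_k].
    by rewrite p_zigzags imset_f.
  case/imsetP => i _ di; have : porbit (zz H) d \in band n (p i).
    by rewrite mem_band // -di porbit_id.
  by have [_ <-] := zB i => /imsetP[j _ ->]; exists (i, j).
exists face; split.
- move=> d i j; apply/idP/eqP => [dz|fd].
    have := fP d; rewrite -(mem_porbits (z_zz i j) dz) => /z_inj ->.
    exact: surjective_pairing.
  by have := fP d; rewrite fd /= => <-; apply: porbit_id.
- move=> d; have := fP (zz H d); rewrite porbit_step fP => /z_inj.
  by rewrite -!surjective_pairing.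
- move=> [i j]; have /porbits_inP[x cx] := z_zz i j; exists x.
  have := fP x; rewrite -cx => /z_inj ->; exact: surjective_pairing.
Qed.

End BandLabelling.

Lemma zigzags_conjugate_dual (T : triangulation) (w : side T -> bool)
  (Hw : bicolouring w) : zigzags (conjugate (dual_graph Hw)) = vertices T.
Proof. by rewrite /zigzags zz_conjugate. Qed.

Lemma card_ribbon_vertices (G : ribbon) :
  #|dart G| = #|porbits (rot G)| * 3.
Proof. by apply: card_porbits_order3; [apply: rot3 | apply: rot_neq]. Qed.

Lemma card_white (G : ribbon) : #|dart G| = #|[pred d | @white G d]| * 2.
Proof.
rewrite -(cardC [pred d | @white G d]) muln2 -addnn; congr (_ + _).
rewrite -(card_image (@perm_inj _ (opp G)) [pred d | @white G d]).
apply: eq_card => d; rewrite !inE; apply/idP/imageP => [wd|[e we ->]].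
  by exists (opp G d); rewrite ?oppK // inE white_opp.
by rewrite white_opp negbK.
Qed.

(** * Integer matrices *)

Local Open Scope ring_scope.

(** The rows of [M] are a basis of a direct summand of the lattice of integer
    row vectors. *)
Definition primitive_rows (a e : nat) (M : 'M[int]_(a, e)) : Prop :=
  forall (q : int) (m : 'rV[int]_a),
    (forall j, (q %| (m *m M) ord0 j)%Z) -> forall i, (q %| m ord0 i)%Z.

Lemma dvdz_mulmx (a e : nat) (q : int) (m : 'rV[int]_a) (M : 'M[int]_(a, e)) :
  (forall i, (q %| m ord0 i)%Z) -> forall j, (q %| (m *m M) ord0 j)%Z.
Proof.
by move=> qm j; rewrite mxE; apply: rpred_sum => i _; apply: dvdz_mulr (qm i).
Qed.

(** The elementary divisors of a matrix with primitive rows are units, so its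
    Smith normal form completes it to an invertible matrix. *)
Lemma primitive_complete (a e : nat) (M : 'M[int]_(a, e)) : primitive_rows M ->
  exists (N : nat) (W : 'M[int]_(N, e)) (X : 'M[int]_(e, a)) (Y : 'M[int]_(e, N)),
    [/\ (a + N)%N = e, M *m X = 1%:M, M *m Y = 0,
        W *m X = 0 /\ W *m Y = 1%:M & X *m M + Y *m W = 1%:M].
Proof.
move=> Mp; have [L Lu [R Ru [d _ Md]]] := int_Smith_normal_form M.
set D := (\matrix_(i, j) _) in Md.
have rowM i j : (row i (invmx L) *m M) ord0 j = (row i D *m R) ord0 j.
  by rewrite -!row_mul Md -!mulmxA mulKmx.
(* The product of [M] with a row of [L^-1] beyond the columns of [D] would be
   zero, and primitivity for the modulus zero would make this row zero. *)
have lt_ae (i : 'I_a) : (i < e)%N.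
  rewrite ltnNge; apply/negP => e_i.
  have /(_ _ _)/= z := Mp 0 (row i (invmx L)).
  have {}z : row i (invmx L) = 0.
    apply/rowP => j; rewrite [RHS]mxE; apply/eqP; rewrite -dvd0z; apply: z => {}j.
    rewrite rowM (_ : row i D = 0) ?mul0mx ?mxE ?dvdzz //.
    apply/rowP => l; rewrite !mxE; case: eqP => // il.
    by have := ltn_ord l; rewrite -il ltnNge e_i.
  have := congr1 (fun v => (v *m L) ord0 i) z; rewrite -row_mul mulVmx // mul0mx.
  by rewrite !mxE eqxx.
(* As [d`_i] divides the row [i] of [L^-1 M], it divides that of [L^-1]. *)
have d_unit (i : 'I_a) : d`_i \is a GRing.unit.
  have dL : forall j, (d`_i %| (row i (invmx L)) ord0 j)%Z.
    apply: Mp => j; rewrite rowM.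
    apply: dvdz_mulmx => l; rewrite !mxE.
    by case: eqP => // _; rewrite dvdz0.
  have := dvdz_mulmx L dL i; rewrite -row_mul mulVmx // !mxE eqxx /=.
  by rewrite dvdz1 => /eqP; case: (d`_i) => [[|[]]|[|]].
have [N eN] : exists N, (a + N)%N = e.
  exists (e - a)%N; rewrite subnKC //; case: (a) lt_ae => // a' /(_ ord_max).
  exact.
subst e; clear lt_ae.
pose Dl : 'M[int]_a := diag_mx (\row_i d`_i).
have Du : L *m Dl \in unitmx.
  rewrite unitmx_mul Lu unitmxE det_diag unitr_prod_in // => i _.
  by rewrite mxE d_unit.
have DE : D = row_mx Dl 0.
  apply/matrixP => i j; rewrite [RHS]mxE; case: splitP => j' jE; rewrite !mxE jE.
    by rewrite -val_eqE /=; case: eqP.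
  by case: eqP => // il; have := ltn_ord i; rewrite il ltnNge leq_addr.
have RE : R = col_mx (usubmx R) (dsubmx R) by rewrite vsubmxK.
have VE : invmx R = row_mx (lsubmx (invmx R)) (rsubmx (invmx R)).
  by rewrite hsubmxK.
set R1 := usubmx R in RE; set R2 := dsubmx R in RE.
set V1 := lsubmx _ in VE; set V2 := rsubmx _ in VE.
have ME : M = L *m Dl *m R1.
  by rewrite Md DE RE -mulmxA mul_row_col mul0mx addr0 mulmxA.
have RV : block_mx (R1 *m V1) (R1 *m V2) (R2 *m V1) (R2 *m V2)
    = block_mx 1%:M 0 0 1%:M.
  by rewrite -mul_col_row -VE -RE mulmxV // scalar_mx_block.
have [R11 R12 R21 R22] := eq_block_mx RV.
exists N, R2, (V1 *m invmx (L *m Dl)), V2; split=> //.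
- by rewrite ME mulmxA -(mulmxA _ R1) R11 mulmx1 mulmxV.
- by rewrite ME -mulmxA R12 mulmx0.
- by rewrite mulmxA R21 mul0mx.
- rewrite ME mulmxA mulmxKV // -mul_row_col -VE -RE.
  by rewrite mulVmx.
Qed.

(** Exactness: if [B] and [P] have primitive rows and [B P^T = 0], a
    basis of the lattice consists of the rows of [B], of [N] rows [W] that
    are, like those of [B], orthogonal to [P], and of rows [Q] dual to [P]. *)
Lemma primitive_complex (a b e : nat) (B : 'M[int]_(a, e)) (P : 'M[int]_(b, e)) :
    primitive_rows B -> primitive_rows P -> B *m P^T = 0 ->
  exists (N : nat) (W : 'M[int]_(N, e)) (X : 'M[int]_(e, a))
      (Y : 'M[int]_(e, N)) (Q : 'M[int]_(b, e)),
    [/\ (a + b + N)%N = e, X *m B + Y *m W + P^T *m Q = 1%:M,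
        W *m Y = 1%:M, W *m X = 0 /\ W *m P^T = 0 & B *m X = 1%:M /\ B *m Y = 0].
Proof.
move=> Bp Pp BP.
have [_ [_ [C [_ [_ PC _ _ _]]]]] := primitive_complete Pp.
have QP : C^T *m P^T = 1%:M by rewrite -trmx_mul PC trmx1.
move: C^T QP => Q QP {PC}.
have Mp : primitive_rows (col_mx B Q).
  move=> q m; rewrite -[m]hsubmxK mul_row_col => qm.
  have q2 i : (q %| rsubmx m ord0 i)%Z.
    have := dvdz_mulmx P^T qm i.
    by rewrite mulmxDl -!mulmxA BP QP mulmx0 add0r mulmx1.
  have q1 : forall i, (q %| lsubmx m ord0 i)%Z.
    apply: Bp => j; have := qm j; rewrite mxE rpredDr //.
    exact: dvdz_mulmx.
  by move=> i; rewrite mxE; case: splitP => i' _.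
have [N [W [X [Y [abN MX MY [WX WY] XM]]]]] := primitive_complete Mp.
rewrite -[X]hsubmxK in MX WX XM.
move: (lsubmx X) (rsubmx X) MX WX XM => X1 X2; rewrite mul_col_row scalar_mx_block.
case/eq_block_mx => BX1 BX2 QX1 QX2; rewrite mul_mx_row -[0]row_mx0.
case/eq_row_mx => WX1 WX2; rewrite mul_row_col => XM.
move: MY; rewrite mul_col_mx -[0]col_mx0 => /eq_col_mx[BY QY].
have X2E : X2 = P^T - Y *m (W *m P^T).
  have := congr1 (mulmx^~ P^T) XM; rewrite /= !mulmxDl -!mulmxA BP QP mulmx0 mulmx1.
  by rewrite add0r mul1mx => /(canRL (addrK _)).
(* Correcting [W] by the rows of [Q] makes it orthogonal to [P], and replaces the
   part of the inverse basis that is dual to [Q] by [P^T]. *)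
exists N, (W - W *m P^T *m Q), X1, Y, Q; split=> //.
- rewrite -[RHS]XM X2E mulmxBr mulmxBl !mulmxA -!addrA; congr (_ + _).
  by rewrite addrC -!addrA [in RHS]addrC -!addrA; congr (_ + _); rewrite addrC.
- by rewrite mulmxBl WY -(mulmxA _ Q) QY mulmx0 subr0.
- split; first by rewrite mulmxBl WX1 -(mulmxA _ Q) QX1 mulmx0 subr0.
  by rewrite mulmxBl -(mulmxA _ Q) QP mulmx1 subrr.
Qed.

(** * Edges, faces and vertices of a bipartite ribbon graph *)

Section Incidence.
Variable G : ribbon.

(** Every edge is oriented away from its white end. *)
Definition white_dart (i : 'I_#|[pred d | @white G d]|) : dart G := enum_val i.

Lemma white_white_dart i : white (white_dart i).
Proof. exact: (enum_valP i). Qed.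

Lemma white_dartP d : white d -> exists i, d = white_dart i.
Proof.
move=> wd; have wd' : d \in [pred d | @white G d] by [].
by exists (enum_rank_in wd' d); rewrite /white_dart enum_rankK_in.
Qed.

Lemma dart_cases d : exists i, d = white_dart i \/ d = opp G (white_dart i).
Proof.
case wd: (white d); first by have [i ->] := white_dartP wd; exists i; left.
have /white_dartP[i di] : white (opp G d) by rewrite white_opp wd.
by exists i; right; rewrite -di oppK.
Qed.

Lemma big_darts (R : Type) (idx : R) (op : Monoid.com_law idx) (F : dart G -> R) :
  \big[op/idx]_d F d
    = \big[op/idx]_i op (F (white_dart i)) (F (opp G (white_dart i))).
Proof.
rewrite big_split (bigID (@white G)) /=; congr (op _ _).
  exact: (big_enum_val (A := [pred d | @white G d])).
rewrite (reindex_inj (@perm_inj _ (opp G))) /=.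
rewrite -(big_enum_val (A := [pred d | @white G d]) (fun d => F (opp G d))).
by apply: eq_bigl => d; rewrite white_opp negbK.
Qed.

(** For the map [phi] from darts to faces or to initial vertices this is the
    matrix of the boundary of faces, respectively of the coboundary of vertices
    up to sign, with the row of [f0] left out: the sum of all rows is zero. *)
Definition incidence (F : finType) (phi : dart G -> F) (f0 : F) :
    'M[int]_(#|predC1 f0|, #|[pred d | @white G d]|) :=
  \matrix_(i, j) ((phi (white_dart j) == enum_val i)%:R
                  - (phi (opp G (white_dart j)) == enum_val i)%:R).

(** A combination of the rows is divisible by [q] only if its coefficients agree
    modulo [q] on any two faces, or vertices, that share an edge, hence on all. As the row of
    [f0] is left out they then agree with zero. *)
Lemma incidence_primitive (F : finType) (phi : dart G -> F) (f0 : F) :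
    (forall f, exists d, phi d = f) ->
    (forall g : F -> bool, (forall d, g (phi (opp G d)) = g (phi d)) ->
       forall f f', g f = g f') ->
  primitive_rows (incidence phi f0).
Proof.
move=> phi_surj phi_conn q m qm.
pose c f : int := \sum_i m ord0 i * (f == enum_val i)%:R.
have cE i : c (enum_val i) = m ord0 i.
  rewrite /c (bigD1 i) //= eqxx mulr1 big1 ?addr0 // => j ji.
  by rewrite (inj_eq enum_val_inj) eq_sym (negbTE ji) mulr0.
have c0 : c f0 = 0.
  rewrite /c big1 // => i _; have := enum_valP i; rewrite inE eq_sym => /negbTE->.
  by rewrite mulr0.
have qw i : (q %| c (phi (white_dart i)) - c (phi (opp G (white_dart i))))%Z.
  have := qm i; rewrite mxE; suff -> : \sum_j m ord0 j * incidence phi f0 j i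
    = c (phi (white_dart i)) - c (phi (opp G (white_dart i))) by [].
  by rewrite -sumrB; apply: eq_bigr => j _; rewrite mxE mulrBr.
have qd d : (q %| c (phi d))%Z = (q %| c (phi (opp G d)))%Z.
  suff qi i : (q %| c (phi (white_dart i)))%Z
            = (q %| c (phi (opp G (white_dart i))))%Z.
    by have [i [->|->]] := dart_cases d; rewrite ?oppK qi.
  by rewrite -{1}[c _](subrK (c (phi (opp G (white_dart i))))) rpredDl.
move=> i; rewrite -cE (phi_conn (fun f => q %| c f)%Z _ _ f0) ?c0 ?dvdz0 //.
Qed.

(** The boundary of a face is a cycle: the path that follows [d] continues with
    [zz G d], which starts at the vertex where [d] ends. *)
Lemma incidence_orthogonal (F V : finType) (face : dart G -> F)
    (vert : dart G -> V) f0 v0 :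
    (forall d, face (zz G d) = face d) -> (forall d, vert (rot G d) = vert d) ->
  incidence face f0 *m (incidence vert v0)^T = 0.
Proof.
move=> face_zz vert_rot; apply/matrixP => i j; rewrite !mxE.
pose f d : int := (face d == enum_val i)%:R.
pose v d : int := (vert d == enum_val j)%:R.
have -> : \sum_l incidence face f0 i l * (incidence vert v0)^T l j
    = \sum_d f d * (v d - v (opp G d)).
  rewrite big_darts; apply: eq_bigr => l _.
  rewrite !mxE oppK -/(f _) -/(f _) -/(v _).
  by rewrite -/(v _) mulrBl -[v (opp _ _) - _]opprB mulrN.
have v_opp d : v (opp G d) = v (zz G d).
  rewrite /v permM; congr ((_ == _)%:R); case wd: (white (opp G d)).
    by rewrite twist_white.
  by rewrite twist_black ?wd // -[in LHS](permKV (rot G) (opp G d)) vert_rot.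
under eq_bigr => d _ do rewrite mulrBr v_opp.
rewrite sumrB; apply/eqP; rewrite subr_eq0; apply/eqP.
rewrite (reindex_inj (@perm_inj _ (zz G))) /=.
by apply: eq_bigr => d _; rewrite /f face_zz.
Qed.

End Incidence.

(** * Monomial maps between tori *)

Section Monomials.
Variable K : fieldType.

(** The homomorphism of tori with matrix of exponents [U]. *)
Definition monomials (I J : finType) (U : I -> J -> int) (x : J -> K) (i : I) : K :=
  \prod_j x j ^ U i j.

Lemma monomials_neq0 (I J : finType) (U : I -> J -> int) x i :
  (forall j, x j != 0) -> monomials U x i != 0.
Proof. by move=> x0; apply/prodf_neq0 => j _; rewrite expfz_neq0. Qed.

Lemma expfz_sum (I : finType) (x : K) (u : I -> int) :
  x != 0 -> x ^ (\sum_i u i) = \prod_i x ^ u i.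
Proof. by move=> x0; apply: (big_morph _ _ (expr0z x)) => a b; exact: expfzDr. Qed.

Lemma expfz_prod (I : finType) (x : I -> K) (m : int) :
  (\prod_i x i) ^ m = \prod_i x i ^ m.
Proof. by apply: (big_morph (fun y => y ^ m)) => [a b|]; rewrite ?expfzMl ?exp1rz. Qed.

Lemma monomials_comp (I J L : finType) (U : I -> J -> int) (U' : J -> L -> int) x i :
    (forall l, x l != 0) ->
  monomials U (monomials U' x) i
    = monomials (fun i l => \sum_j U i j * U' j l) x i.
Proof.
move=> x0; rewrite /monomials.
under [RHS]eq_bigr => l _ do rewrite expfz_sum //.
rewrite exchange_big; apply: eq_bigr => j _ /=.
by rewrite expfz_prod; apply: eq_bigr => l _; rewrite mulrC exprz_exp.
Qed.

Lemma monomialsM (I J : finType) (U : I -> J -> int) x y i :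
  monomials U (fun j => x j * y j) i = monomials U x i * monomials U y i.
Proof.
by rewrite /monomials -big_split; apply: eq_bigr => j _; rewrite expfzMl.
Qed.

Lemma eq_monomials (I J : finType) (U : I -> J -> int) x y i :
  x =1 y -> monomials U x i = monomials U y i.
Proof. by move=> xy; apply: eq_bigr => j _; rewrite xy. Qed.

Section Matrices.
Variables (a b : nat) (M M' : 'M[int]_(a, b)) (x : 'I_b -> K).
Hypothesis x0 : forall j, x j != 0.

Lemma monomials_mulmx c (N : 'M[int]_(c, a)) i :
  monomials (N *m M) x i = monomials N (monomials M x) i.
Proof.
by rewrite monomials_comp //; apply: eq_bigr => j _; rewrite mxE.
Qed.

Lemma monomials_add i :
  monomials (M + M') x i = monomials M x i * monomials M' x i.
Proof.
by rewrite /monomials -big_split; apply: eq_bigr => j _; rewrite mxE expfzDr.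
Qed.

Lemma monomials_id (i : 'I_b) : monomials (1%:M : 'M[int]_b) x i = x i.
Proof.
rewrite /monomials (bigD1 i) //= big1 ?mulr1 => [|j ji]; rewrite mxE ?eqxx //.
by rewrite eq_sym (negbTE ji).
Qed.

Lemma monomials_0 i : monomials (0 : 'M[int]_(a, b)) x i = 1.
Proof. by rewrite /monomials big1 // => j _; rewrite mxE. Qed.

End Matrices.

Lemma laurent_monomials (I J : finType) (c : I -> K) (U : I -> J -> int)
    (u : torus_point K J -> torus_point K I) (f : torus_point K I -> K) :
    (forall i, c i != 0) ->
    (forall y i, sval (u y) i = c i * monomials U (sval y) i) ->
  laurent f -> laurent (f \o u).
Proof.
move=> c0 uE [s fE].
exists (map (fun t : K * {ffun I -> int} =>
  (t.1 * \prod_i c i ^ t.2 i, [ffun j => \sum_i t.2 i * U i j])) s).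
move=> y; rewrite /= fE big_map; apply: eq_bigr => t _ /=.
rewrite -mulrA; congr (_ * _).
under eq_bigr => i _ do rewrite uE expfzMl.
rewrite big_split; congr (_ * _) => /=.
have y0 := svalP y.
have := @monomials_comp _ _ _ (fun _ : unit => t.2) U (sval y) tt y0.
rewrite {1}/monomials => ->.
by apply: eq_bigr => j _; rewrite ffunE.
Qed.

End Monomials.

(** * Connections *)

Lemma sval_inj (T : Type) (P : T -> Prop) : injective (@sval T P).
Proof.
by case=> x Px [y Py] /= xy; subst y; congr exist; apply: Prop_irrelevance.
Qed.

Lemma eqclass_ex (X : Type) (e : X -> X -> Prop) (c : eqclass e) :
  exists x, to_eqclass e x = c.
Proof. by case: c => c [x cx]; exists x; apply: sval_inj; rewrite /= cx. Qed.

Section Connections.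
Variables (K : fieldType) (G : ribbon).
Implicit Types (A B : point (connections K G)) (d : dart G).
Local Notation wd := (@white_dart G).

Lemma scalar_neq0 A d : scalar A d != 0.
Proof. exact: (svalP (sval A)). Qed.

Lemma scalar_opp A d : scalar A (opp G d) = (scalar A d)^-1.
Proof. exact: (svalP A). Qed.

Lemma gauge_refl A : gauge_equiv A A.
Proof.
exists (fun=> 1) => [v|d]; first exact: oner_neq0.
by rewrite mul1r divr1.
Qed.

Lemma gauge_sym A B : gauge_equiv A B -> gauge_equiv B A.
Proof.
case=> h h0 AB; exists (fun v => (h v)^-1) => [v|d]; first by rewrite invr_eq0.
by rewrite AB invrK !mulrA mulVf // mul1r mulfVK.
Qed.

Lemma gauge_trans A B C : gauge_equiv A B -> gauge_equiv B C -> gauge_equiv A C.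
Proof.
case=> h h0 AB [h' h'0 BC]; exists (fun v => h v * h' v) => [v|d].
  by rewrite mulf_neq0.
by rewrite BC AB invfM !mulrA [h' _ * h _]mulrC -!mulrA [(h _)^-1 * _]mulrC.
Qed.

Lemma gauge_class A B :
  to_eqclass (@gauge_equiv K G) A = to_eqclass (@gauge_equiv K G) B <->
  gauge_equiv A B.
Proof.
split=> [/(congr1 sval) /= AB|AB]; first by rewrite AB; apply: gauge_refl.
apply: sval_inj => /=; apply/funext => C; apply/propext.
by split; apply: gauge_trans => //; apply: gauge_sym.
Qed.

Definition white_scalars A : 'I_#|[pred d | @white G d]| -> K :=
  fun i => scalar A (wd i).

Lemma white_scalars_neq0 A i : white_scalars A i != 0.
Proof. exact: scalar_neq0. Qed.

(** The scalar attached to a dart in terms of those of the white darts: the white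
    dart of the edge itself, or its inverse. *)
Definition edge_exponents (d : dart G) (i : 'I_#|[pred d | @white G d]|) : int :=
  (d == wd i)%:R - (d == opp G (wd i))%:R.

Lemma edge_exponents_opp d i : edge_exponents (opp G d) i = - edge_exponents d i.
Proof.
rewrite /edge_exponents opprB (inj_eq (@perm_inj _ (opp G))).
by rewrite -{1}(oppK (wd i)) (inj_eq (@perm_inj _ (opp G))).
Qed.

Lemma connection_of_proof (x : 'I_#|[pred d | @white G d]| -> K) :
    (forall i, x i != 0) ->
  exists A, forall d, scalar A d = monomials edge_exponents x d.
Proof.
move=> x0; pose f := [ffun d => monomials edge_exponents x d].
have f0 d : f d != 0 by rewrite ffunE monomials_neq0.
have fo d : f (opp G d) = (f d)^-1.
  rewrite !ffunE /monomials -prodfV; apply: eq_bigr => i _.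
  by rewrite edge_exponents_opp invr_expz.
exists (exist _ (exist _ f f0) fo) => d; exact: ffunE.
Qed.

Definition connection_of (x : 'I_#|[pred d | @white G d]| -> K)
    (x0 : forall i, x i != 0) : point (connections K G) :=
  sval (cid (connection_of_proof x0)).

Lemma scalar_connection_of x (x0 : forall i, x i != 0) d :
  scalar (connection_of x0) d = monomials edge_exponents x d.
Proof. exact: (svalP (cid (connection_of_proof x0)) d). Qed.

Lemma white_scalars_connection_of x (x0 : forall i, x i != 0) :
  white_scalars (connection_of x0) =1 x.
Proof.
move=> i; rewrite /white_scalars scalar_connection_of /monomials.
rewrite (bigD1 i) //= big1 ?mulr1 /edge_exponents => [|j ji].
  rewrite eqxx; case: eqP => [e|_]; last by rewrite subr0 expr1z.
  by have := white_white_dart i; rewrite {1}e white_opp white_white_dart.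
rewrite (inj_eq enum_val_inj) eq_sym (negbTE ji).
case: eqP => [e|_]; last by rewrite subrr expr0z.
by have := white_white_dart i; rewrite e white_opp white_white_dart.
Qed.

End Connections.

Section Locus.
Variables (K : fieldType) (G : ribbon) (k n : nat).
Variables (zeta : 'I_k -> 'I_n -> {set dart G}) (face : dart G -> 'I_k * 'I_n).
Hypothesis zetaE : forall d i j, (d \in zeta i j) = (face d == (i, j)).
Hypothesis face_zz : forall d, face (zz G d) = face d.
Hypothesis face_surj : forall f, exists d, face d = f.
Hypothesis Gc : ribbon_connected G.
Implicit Types (A B : point (connections K G)) (d : dart G) (f : 'I_k * 'I_n).
Local Notation wd := (@white_dart G).

Let monodromyE A i j :
  monodromy A (zeta i j) = \prod_(d | face d == (i, j)) scalar A d.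
Proof. by apply: eq_bigl => d; rewrite zetaE. Qed.

(** Along a closed path the changes of basis cancel, as each step starts where the
    previous one ends. *)
Lemma monodromy_gauge A B i j :
  gauge_equiv A B -> monodromy B (zeta i j) = monodromy A (zeta i j).
Proof.
case=> h h0 AB; rewrite !monodromyE; under eq_bigr => d _ do rewrite AB.
rewrite !big_split /= prodfV mulrAC -[RHS]mul1r; congr (_ * _).
have -> : \prod_(d | face d == (i, j)) h (vertex (opp G d))
    = \prod_(d | face d == (i, j)) h (vertex d).
  rewrite [RHS](reindex_inj (@perm_inj _ (zz G))) /=.
  under [RHS]eq_bigl => d do rewrite face_zz.
  apply: eq_bigr => d _; congr h; rewrite /vertex permM; apply/eqP.
  case wd: (white (opp G d)); first by rewrite twist_white // porbit_step.
  by rewrite twist_black ?wd // -{1}(permKV (rot G) (opp G d)) porbit_step.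
by rewrite divff //; apply/prodf_neq0.
Qed.

(** Each edge is followed twice, once in each direction: by the path of its white
    dart and by that of its black one. *)
Lemma prod_monodromies A (m : 'I_k -> 'I_n -> int) :
  \prod_i \prod_j monodromy A (zeta i j) ^ m i j
    = \prod_i scalar A (wd i) ^ (m (face (wd i)).1 (face (wd i)).2
                         - m (face (opp G (wd i))).1 (face (opp G (wd i))).2).
Proof.
rewrite pair_big /=.
transitivity (\prod_d scalar A d ^ m (face d).1 (face d).2); last first.
  rewrite big_darts; apply: eq_bigr => i _ /=.
  by rewrite scalar_opp exprz_inv expfzDr ?scalar_neq0.
rewrite (partition_big face predT) //=; apply: eq_bigr => f _.
rewrite monodromyE -surjective_pairing.
rewrite (big_morph (fun y => y ^ m f.1 f.2) (id1 := 1) (op1 := *%R)).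
- by apply: eq_bigr => d /eqP->.
- by move=> x y; rewrite expfzMl.
- exact: exp1rz.
Qed.

Lemma prod_monodromies1 A : \prod_i \prod_j monodromy A (zeta i j) = 1.
Proof.
transitivity (\prod_i \prod_j monodromy A (zeta i j) ^ (1 : int)).
  by apply: eq_bigr => i _; apply: eq_bigr => j _; rewrite expr1z.
by rewrite (prod_monodromies A (fun _ _ => 1)) big1.
Qed.

(** The path of [d] is that of [zz G d] and crossing an edge exchanges [d] and
    [opp G d]; together these generate the rotation around the vertices. *)
Lemma faces_connected (g : 'I_k * 'I_n -> bool) :
  (forall d, g (face (opp G d)) = g (face d)) -> forall f f', g f = g f'.
Proof.
move=> go f f'; have [d <-] := face_surj f; have [d' <-] := face_surj f'.
apply: (Gc (f := fun d => g (face d))) => {d d'} // d.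
apply: (@rot_invar G _ (fun d => g (face d))) => {}d.
by rewrite -{1}(oppK d) -[twist G _]/((twist G) _) -permM face_zz go.
Qed.

(** Divide by the other factors the equality of the two products, both one. *)
Lemma monodromy_last A (lam : 'I_k -> 'I_n -> K) i0 j0 :
    (forall i j, lam i j != 0) -> \prod_i \prod_j lam i j = 1 ->
    (forall i j, (i, j) <> (i0, j0) -> monodromy A (zeta i j) = lam i j) ->
  monodromy A (zeta i0 j0) = lam i0 j0.
Proof.
move=> lam0 lam1 Alam.
have: \prod_i \prod_j monodromy A (zeta i j) = \prod_i \prod_j lam i j.
  by rewrite lam1 prod_monodromies1.
rewrite !pair_big /=.
rewrite !(bigD1 (P := xpredT) (i0, j0)) //=.
rewrite (eq_bigr (fun f => lam f.1 f.2)) => [|[i j] /eqP f0]; last exact: (Alam i j).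
by apply: mulIf; apply/prodf_neq0 => f _; apply: lam0.
Qed.

End Locus.

Section LocusIsTorus.
Variables (K : fieldType) (G : ribbon) (k n : nat).
Variables (zeta : 'I_k -> 'I_n -> {set dart G}) (face : dart G -> 'I_k * 'I_n).
Hypothesis zetaE : forall d i j, (d \in zeta i j) = (face d == (i, j)).
Hypothesis face_zz : forall d, face (zz G d) = face d.
Hypothesis face_surj : forall f, exists d, face d = f.
Hypothesis Gc : ribbon_connected G.
Implicit Types (A B : point (connections K G)) (d : dart G) (f : 'I_k * 'I_n).
Local Notation wd := (@white_dart G).

Let V : finType := {c : {set dart G} | c \in porbits (rot G)}.

Let initial (d : dart G) : V := exist _ (vertex d) (imset_f _ isT).

Let initial_rot d : initial (rot G d) = initial d.
Proof. by apply: val_inj; rewrite /= /vertex porbit_step. Qed.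

Let initial_surj v : exists d, initial d = v.
Proof.
by case: v => c cV; have /porbits_inP[d cd] := cV; exists d; apply: val_inj.
Qed.

Let vertices_connected (g : V -> bool) :
  (forall d, g (initial (opp G d)) = g (initial d)) -> forall v v', g v = g v'.
Proof.
move=> go v v'; have [d <-] := initial_surj v; have [d' <-] := initial_surj v'.
by apply: (Gc (f := fun d => g (initial d))) => // e; rewrite initial_rot.
Qed.

Variables (f0 : 'I_k * 'I_n) (d0 : dart G).
Let v0 := initial d0.
Let B := incidence face f0.
Let P := incidence initial v0.

Let face_lam (lam : 'I_k -> 'I_n -> K) (r : 'I_#|predC1 f0|) : K :=
  lam (enum_val r).1 (enum_val r).2.

(** The rows of [B] are the exponents of the monodromies. *)
Let monodromy_incidence A r :
  monomials B (white_scalars A) r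
    = monodromy A (zeta (enum_val r).1 (enum_val r).2).
Proof.
rewrite /monodromy (eq_bigl _ _ (fun d => zetaE d _ _)) -surjective_pairing.
rewrite big_mkcond big_darts; apply: eq_bigr => j _ /=; rewrite mxE scalar_opp.
rewrite /white_scalars; case: eqP => _; case: eqP => _.
- by rewrite subrr expr0z divff ?scalar_neq0.
- by rewrite subr0 expr1z mulr1.
- by rewrite sub0r exprN1 mul1r.
- by rewrite subr0 expr0z mulr1.
Qed.

(** The row of [f0] may be left out, as the product of all monodromies is one. *)
Let monodromies_incidence A (lam : 'I_k -> 'I_n -> K) :
    (forall i j, lam i j != 0) -> \prod_i \prod_j lam i j = 1 ->
  (forall i j, monodromy A (zeta i j) = lam i j) <->
  (forall r, monomials B (white_scalars A) r = face_lam lam r).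
Proof.
move=> lam0 lam1; split=> [Alam r|Blam i j]; first by rewrite monodromy_incidence.
have Alam i' j' : (i', j') <> f0 -> monodromy A (zeta i' j') = lam i' j'.
  move=> /eqP f_f0; have f_in : (i', j') \in predC1 f0 by [].
  have := Blam (enum_rank_in f_in (i', j')).
  by rewrite monodromy_incidence /face_lam enum_rankK_in.
have [ij0|] := eqVneq (i, j) f0; last by move/eqP/Alam.
move: Alam; rewrite -ij0; exact: (monodromy_last zetaE).
Qed.

(** Gauge transformations multiply the scalars by the monomials with exponents
    [P^T]; it is enough to change the bases at the vertices other than [v0]. *)
Let gauge_incidence A A' :
  gauge_equiv A A' <->
  exists2 t : 'I_#|predC1 v0| -> K, (forall r, t r != 0) &
    forall i, white_scalars A' i = white_scalars A i * monomials P^T t i.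
Proof.
split=> [[h h0 AA']|[t t0 AA']].
  (* The same gauge transformation, normalized to [1] at [v0]. *)
  pose h' (v : V) := h (val v) / h (val v0).
  have h'0 v : h' v != 0 by rewrite mulf_neq0 ?invr_eq0.
  exists (fun r => (h' (enum_val r))^-1) => [r|i]; first by rewrite invr_eq0.
  have hE v :
      h' v = \prod_(r < #|predC1 v0|) h' (enum_val r) ^ (v == enum_val r)%:Z.
    have [->|v_v0] := eqVneq v v0.
      rewrite big1 => [|r _]; first by rewrite /h' divff.
      by have := enum_valP r; rewrite inE eq_sym => /negbTE->; rewrite expr0z.
    have v_in : v \in predC1 v0 by [].
    rewrite (bigD1 (enum_rank_in v_in v)) //= enum_rankK_in // eqxx expr1z.
    rewrite big1 ?mulr1 // => r; rewrite -(inj_eq enum_val_inj) enum_rankK_in //.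
    by rewrite eq_sym => /negbTE->; rewrite expr0z.
  rewrite {1}/white_scalars AA' [h _ * _]mulrC -mulrA; congr (_ * _).
  have -> : h (vertex (opp G (wd i))) / h (vertex (wd i))
      = h' (initial (opp G (wd i))) / h' (initial (wd i)).
    by rewrite /h' /= invfM invrK mulrACA mulVf // mulr1.
  rewrite [h' (initial (opp _ _))]hE [h' (initial (wd i))]hE.
  rewrite -prodf_div; apply: eq_bigr => r _; rewrite !mxE.
  by rewrite exprz_inv opprB expfzDr // invr_expz !natz.
pose h c := \prod_(r < #|predC1 v0|) t r ^ - ((c == val (enum_val r))%:Z).
have h0 c : h c != 0 by apply/prodf_neq0 => r _; rewrite expfz_neq0.
exists h => // d.
have hw i : scalar A' (wd i)
    = h (vertex (opp G (wd i))) * scalar A (wd i) / h (vertex (wd i)).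
  rewrite [LHS]AA' mulrC mulrAC; congr (_ * _).
  rewrite -prodf_div; apply: eq_bigr => r _; rewrite !mxE invr_expz -expfzDr //.
  by rewrite opprK addrC !natz.
have [i [->|->]] := dart_cases d; first exact: hw.
rewrite !scalar_opp hw oppK !invfM invrK.
by rewrite mulrC mulrA mulrAC.
Qed.

(** As [B] and [P] have primitive rows and [B P^T = 0], the lattice of exponents
    splits: with the monodromies given, the invariant monomials [W] are
    coordinates on the quotient by gauge transformations, and every choice of
    them is attained. *)
Lemma locus_isomorphic_torus (lam : 'I_k -> 'I_n -> K) :
    (forall i j, lam i j != 0) -> \prod_i \prod_j lam i j = 1 ->
  exists2 N, (N + #|porbits (rot G)| + k * n
              = #|[pred d | @white G d]| + 2)%N &
    isomorphic (monodromy_locus zeta lam) (torus K 'I_N).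
Proof.
move=> lam0 lam1.
have Bp : primitive_rows B.
  by apply: incidence_primitive => //; apply: faces_connected face_zz face_surj Gc.
have Pp : primitive_rows P by apply: incidence_primitive.
have BP : B *m P^T = 0 by apply: incidence_orthogonal.
have [N [W [X [Y [Q [dimN XYQ WY [WX WP] [BX BY]]]]]]] :=
  primitive_complex Bp Pp BP.
exists N.
  have cF : #|predC1 f0|.+1 = (k * n)%N.
    have kn_gt0 : (0 < k * n)%N.
      have [i j] := f0; rewrite muln_gt0.
      by rewrite (leq_ltn_trans _ (ltn_ord i)) // (leq_ltn_trans _ (ltn_ord j)).
    by rewrite cardC1 card_prod !card_ord prednK.
  have cV : #|predC1 v0|.+1 = #|porbits (rot G)|.
    have <- : #|V| = #|porbits (rot G)| by rewrite card_sig; apply: eq_card.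
    by rewrite cardC1 prednK //; apply/card_gt0P; exists v0.
  rewrite -dimN -cF -cV !addnS addSn !addn0 -addnA addnC.
  by rewrite (addnC #|predC1 v0|).
pose l := face_lam lam.
have l0 r : l r != 0 by apply: lam0.
(* The scalars on the white darts that have the prescribed monodromies and the
   invariants [y]. *)
pose sol (y : 'I_N -> K) i := monomials X l i * monomials Y y i.
have sol0 y : (forall j, y j != 0) -> forall i, sol y i != 0.
  by move=> y0 i; rewrite mulf_neq0 ?monomials_neq0.
have B_sol y : (forall j, y j != 0) -> forall r, monomials B (sol y) r = l r.
  move=> y0 r; rewrite monomialsM -!monomials_mulmx // BX BY.
  by rewrite monomials_id monomials_0 mulr1.
have W_sol y : (forall j, y j != 0) -> forall j, monomials W (sol y) j = y j.
  move=> y0 r; rewrite monomialsM -!monomials_mulmx // WX WY.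
  by rewrite monomials_id monomials_0 mul1r.
(* [Phi] takes the invariants of a connection, and [Psi] is a section of it that
   meets every gauge class in the locus. *)
pose fPhi A := [ffun j => monomials W (white_scalars A) j].
have fPhi0 A j : fPhi A j != 0.
  by rewrite ffunE monomials_neq0 // => i; apply: white_scalars_neq0.
pose Phi A : torus_point K 'I_N := exist _ (fPhi A) (fPhi0 A).
pose Psi (y : torus_point K 'I_N) := connection_of (sol0 _ (svalP y)).
have wPsi y : white_scalars (Psi y) =1 sol (sval y).
  exact: white_scalars_connection_of.
have PhiPsi y : Phi (Psi y) = y.
  apply: sval_inj; apply/ffunP => j; rewrite ffunE (eq_monomials _ _ (wPsi y)).
  by rewrite W_sol //; apply: (svalP y).
have Phi_gauge A A' : gauge_equiv A A' -> Phi A = Phi A'.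
  move/gauge_incidence => [t t0 AA']; apply: sval_inj; apply/ffunP => j.
  rewrite !ffunE (eq_monomials _ _ AA') monomialsM -monomials_mulmx // WP.
  by rewrite monomials_0 mulr1.
have Psi_lam y i j : monodromy (Psi y) (zeta i j) = lam i j.
  move: i j; apply/monodromies_incidence => // r.
  by rewrite (eq_monomials _ _ (wPsi y)) B_sol //; apply: (svalP y).
have PsiPhi A : (forall i j, monodromy A (zeta i j) = lam i j) ->
    gauge_equiv (Psi (Phi A)) A.
  move/(monodromies_incidence A lam0 lam1) => Al; apply/gauge_incidence.
  have A0 := @white_scalars_neq0 _ _ A.
  exists (monomials Q (white_scalars A)) => [r|i]; first exact: monomials_neq0.
  rewrite wPsi -[LHS](monomials_id (white_scalars A)) -XYQ.
  rewrite !monomials_add // !monomials_mulmx //.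
  rewrite (eq_monomials _ _ Al); congr (_ * _ * _).
  by apply: eq_monomials => j; rewrite ffunE.
have Phi_regular (h : torus_point K 'I_N -> K) :
    laurent h -> @regular _ (connections K G) (h \o Phi).
  pose U j d := \sum_i W j i * (wd i == d)%:R.
  pose fu (x : torus_point K (dart G)) := [ffun j => monomials U (sval x) j].
  have fu0 x j : fu x j != 0 by rewrite ffunE monomials_neq0 //; apply: (svalP x).
  move=> hL; exists (h \o (fun x => exist _ (fu x) (fu0 x))).
    apply: laurent_monomials hL => [j|x j]; first exact: (oner_neq0 K).
    by rewrite mul1r ffunE.
  move=> A; congr (h _); apply: sval_inj; apply/ffunP => j; rewrite !ffunE.
  rewrite -(monomials_comp W (fun i d => (wd i == d)%:R)); last exact: scalar_neq0.
  apply: eq_monomials => i; rewrite /monomials (bigD1 (wd i)) //= eqxx expr1z.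
  by rewrite big1 ?mulr1 // => d; rewrite eq_sym => /negbTE->; rewrite expr0z.
have Psi_regular (h : point (connections K G) -> K) :
    @regular _ (connections K G) h -> laurent (h \o Psi).
  case=> h' h'L hE.
  have -> : h \o Psi = h' \o (fun y => sval (Psi y)).
    by apply/funext => y; rewrite /= hE.
  pose E := @edge_exponents G.
  apply: (laurent_monomials (c := monomials E (monomials X l))
    (U := fun d j => \sum_i E d i * Y i j)) h'L => [d|y d].
    by apply: monomials_neq0 => i; apply: monomials_neq0.
  rewrite -monomials_comp; last exact: (svalP y).
  by rewrite -monomialsM; apply: scalar_connection_of.
pose rep c := sval (cid (eqclass_ex (e := @gauge_equiv K G) c)).
have repK c : to_eqclass _ (rep c) = c := svalP (cid (eqclass_ex c)).
have locus_Psi y A : to_eqclass (@gauge_equiv K G) A = to_eqclass _ (Psi y) ->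
    forall i j, monodromy A (zeta i j) = lam i j.
  move=> /gauge_class/gauge_sym A_y i j.
  by rewrite (monodromy_gauge zetaE face_zz _ _ A_y).
pose psi y : point (monodromy_locus zeta lam) :=
  exist _ (to_eqclass _ (Psi y)) (@locus_Psi y).
pose phi (c : point (monodromy_locus zeta lam)) := Phi (rep (sval c)).
have Phi_rep A : Phi (rep (to_eqclass _ A)) = Phi A.
  by apply: Phi_gauge; apply/gauge_class; rewrite repK.
exists phi; split.
  exists psi => [c|y]; last by rewrite /phi Phi_rep PhiPsi.
  apply: sval_inj => /=; rewrite -[RHS]repK; apply/gauge_class.
  by apply: PsiPhi => i j; apply: (svalP c); apply: repK.
move=> h; split=> [hL|].
  exists (h \o Phi \o rep) => //.
  have := Phi_regular _ hL; congr regular.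
  by apply/funext => A /=; rewrite Phi_rep.
case=> h' h'L hE; have := Psi_regular _ h'L; congr laurent.
by apply/funext => y /=; rewrite -(hE (psi y)) /= /phi Phi_rep PhiPsi.
Qed.

End LocusIsTorus.

(** On a connection with scalar [2] on one edge and [1] on the others, a relation
    says that its exponents at the two faces along this edge agree. *)
Lemma monodromy_relations (K : numFieldType) (G : ribbon) (k n : nat)
    (zeta : 'I_k -> 'I_n -> {set dart G}) (face : dart G -> 'I_k * 'I_n)
    (f0 : 'I_k * 'I_n) (m : 'I_k -> 'I_n -> int) :
    (forall d i j, (d \in zeta i j) = (face d == (i, j))) ->
    (forall d, face (zz G d) = face d) -> (forall f, exists d, face d = f) ->
    ribbon_connected G ->
  (forall A : point (connections K G),
     \prod_(i < k) \prod_(j < n) monodromy A (zeta i j) ^ (m i j) = 1) <->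
  (exists c : int, forall i j, m i j = c).
Proof.
move=> zetaE face_zz face_surj Gc.
split=> [rel|[c mc] A]; last first.
  by rewrite (prod_monodromies zetaE) big1 // => i _; rewrite !mc subrr.
exists (m f0.1 f0.2) => i j; apply/eqP.
rewrite (faces_connected face_zz face_surj Gc
  (g := fun f => m f.1 f.2 == m f0.1 f0.2) _ (i, j) f0) //.
suff me l :
    m (face (white_dart l)).1 (face (white_dart l)).2
      = m (face (opp G (white_dart l))).1 (face (opp G (white_dart l))).2.
  by move=> d; have [l [->|->]] := dart_cases d; rewrite ?oppK me.
pose x j : K := if j == l then 2 else 1.
have x0 j' : x j' != 0 by rewrite /x; case: ifP => _; rewrite ?oner_neq0 ?pnatr_eq0.
have := rel (connection_of x0); rewrite (prod_monodromies zetaE) (bigD1 l) //=.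
rewrite -[scalar _ _]/(white_scalars _ l) white_scalars_connection_of {1}/x eqxx.
rewrite big1 => [|j' j'l]; last first.
  rewrite -[scalar _ _]/(white_scalars _ j') white_scalars_connection_of /x.
  rewrite (negbTE j'l).
  exact: exp1rz.
move/eqP; rewrite mulr1 pexprz_eq1 ?ler0n // (eqr_nat _ 2 1) orbF subr_eq0.
by move/eqP.
Qed.

(** * The theorem *)

Theorem mainTheorem1 (R : realType) (g k n : nat)
    (hk : (1 <= k)%N) (hn : (1 <= n)%N) (hgk : (2 < 2 * g + k)%N) :
  (exists (T : triangulation) (p : 'I_k -> {set side T}) (w : side T -> bool),
     triangulates g p /\ bicolouring w) /\
  (forall (T : triangulation) (p : 'I_k -> {set side T}) (w : side T -> bool)
      (Hw : bicolouring w), triangulates g p ->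
    (exists zeta : 'I_k -> 'I_n -> {set dart (graph_n n Hw)},
       band_labelling p zeta) /\
    (forall zeta : 'I_k -> 'I_n -> {set dart (graph_n n Hw)},
       band_labelling p zeta ->
     (* the relations between the monodromies are generated by: product = 1 *)
     (forall m : 'I_k -> 'I_n -> int,
        (forall A : point (connections R[i] (graph_n n Hw)),
           \prod_(i < k) \prod_(j < n) monodromy A (zeta i j) ^ (m i j) = 1) <->
        (exists c : int, forall i j, m i j = c)) /\
     (forall lam : 'I_k -> 'I_n -> R[i],
        (forall i j, lam i j != 0) ->
        \prod_(i < k) \prod_(j < n) lam i j = 1 ->
      (* any kn - 1 of the equations are independent and imply the last one *)
      (forall (i0 : 'I_k) (j0 : 'I_n),
         (forall m : 'I_k -> 'I_n -> int, m i0 j0 = 0 ->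
            (forall A : point (connections R[i] (graph_n n Hw)),
               \prod_(i < k) \prod_(j < n) monodromy A (zeta i j) ^ (m i j) = 1) ->
            forall i j, m i j = 0) /\
         (forall A : point (connections R[i] (graph_n n Hw)),
            (forall i j, (i, j) <> (i0, j0) ->
               monodromy A (zeta i j) = lam i j) ->
            monodromy A (zeta i0 j0) = lam i0 j0)) /\
      (exists N : nat,
        [/\ N%:Z = n%:Z ^+ 2 * (2 * g%:Z - 2 + k%:Z) - k%:Z * n%:Z + 2,
            N%:Z = 2 * (g%:Z - 1) * n%:Z ^+ 2 + (n%:Z ^+ 2 - n%:Z) * k%:Z + 2
          & isomorphic (monodromy_locus zeta lam) (torus R[i] 'I_N)])))).
Proof.
split; first exact: bicoloured_triangulation_exists.
move=> T p w Hw [p_inj p_im euler].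
pose H := graph_n n Hw.
have p_zz : [set p i | i : 'I_k] = zigzags (conjugate (dual_graph Hw)).
  by rewrite zigzags_conjugate_dual.
have Hc : ribbon_connected H.
  apply: subdivide_connected => //; apply: conjugate_connected.
  exact: dual_graph_connected.
split; first exact: (@bands_labelled_exists n k (conjugate (dual_graph Hw)) p p_zz).
move=> zeta zetaB; have [face [zetaE face_zz face_surj]] :=
  @bands_face n k (conjugate (dual_graph Hw)) p p_inj p_zz zeta zetaB.
pose f0 := (Ordinal hk, Ordinal hn); have [d0 _] := face_surj f0.
have relations m := monodromy_relations (R[i]) f0 m zetaE face_zz face_surj Hc.
split; first exact: relations.
move=> lam lam0 lam1; split=> [i0 j0|].
  split=> [m m0 /relations[c mc] i j|A]; last exact: (monodromy_last zetaE).
  by rewrite mc -(mc i0 j0) m0.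
have [N dimN iso] :=
  locus_isomorphic_torus zetaE face_zz face_surj Hc f0 d0 lam0 lam1.
exists N; suff dimE : N%:Z = n%:Z ^+ 2 * (2 * g%:Z - 2 + k%:Z) - k%:Z * n%:Z + 2.
  by split=> //; rewrite dimE; ring.
have cE := card_edges T; have cT := card_triangles T.
have p_card : #|vertices T| = k by rewrite -p_im card_imset ?card_ord.
rewrite p_card in euler.
have cH : #|dart H| = (#|side T| * (n * n))%N by rewrite card_prod card_small.
have cV := card_ribbon_vertices H; have cW := card_white H; rewrite cH in cV cW.
move: dimN cE cT euler cV cW {iso cH p_card}.
move: #|side T| #|edges T| #|triangles T| #|porbits (rot H)| #|[pred d | @white H d]|.
move=> s e t v wh dimN cE cT euler cV cW.
have sE : s%:Z = 6 * (2 * g%:Z - 2 + k%:Z) by lia.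
have vE : v%:Z = 2 * (2 * g%:Z - 2 + k%:Z) * (n%:Z * n%:Z).
  have : v%:Z * 3 = s%:Z * (n%:Z * n%:Z) by lia.
  by rewrite sE; lia.
have wE : wh%:Z = 3 * (2 * g%:Z - 2 + k%:Z) * (n%:Z * n%:Z).
  have : wh%:Z * 2 = s%:Z * (n%:Z * n%:Z) by lia.
  by rewrite sE; lia.
have -> : N%:Z = wh%:Z + 2 - v%:Z - k%:Z * n%:Z by lia.
by rewrite vE wE; ring.
Qed.
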